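(* Let $X$ be a finite set and let $G\leq \operatorname{Aut}(X^* )$ be a finitely generated self-replicating branch group with the subgroup induction property whose action on $X^*$ is tree-primitive. Let $H\leq G$ be a finitely generated subgroup of $G$. Then $H$ is virtually a block subgroup, i.e. $H$ contains a finite index subgroup which is a block subgroup of $G$.
   Context: Words and automorphisms. $\mathbf{N}=\{0,1,2,\dots\}$. $X^n$ is the set of words of length $n$ over the finite set $X$, $X^*=\bigcup_{n\in\mathbf{N}}X^n$, with partial order $u\leq v$ iff $v=uw$ for some $w\in X^*$; two words are comparable if $u\le v$ or $v\le u$. $\operatorname{Aut}(X^* )$ is the group of automorphisms of the poset $X^*$ (equivalently, of the $|X|$-regular rooted tree). For $g\in\operatorname{Aut}(X^* )$ and $v\in X^*$, the section $\varphi_v(g)\in \operatorname{Aut}(X^* )$ is the unique element with $g\cdot(vw)=(g\cdot v)(\varphi_v(g)\cdot w)$ for all $w\in X^*$. Stabilisers. For $G\leq\operatorname{Aut}(X^* )$: $\operatorname{St}_G(v)$ is the stabiliser of $v$; $\operatorname{St}_G(V)=\bigcap_{v\in V}\operatorname{St}_G(v)$ for $V\subseteq X^*$; $\operatorname{Rist}_G(v)=\{g\in G\mid g\cdot w=w \text{ for all } w\in X^* \text{ with } v\not\leq w\}$; $\operatorname{Rist}_G(V)=\{g\in G\mid g\cdot w=w\text{ for all } w\in X^*\text{ not comparable to any } v\in V\}$; $\operatorname{SRist}_G(V)=\operatorname{Rist}_G(V)\cap \operatorname{St}_G(V)$; for $n\in\mathbf{N}$, $\operatorname{Rist}_G(n)=\langle\bigcup_{v\in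 X^n}\operatorname{Rist}_G(v)\rangle$. Branch, self-replicating. $G$ is a branch group if it acts transitively on $X^n$ for every $n$ and $\operatorname{Rist}_G(n)$ has finite index in $G$ for every $n$. A non-trivial group $G\le\operatorname{Aut}(X^* )$ is self-similar if $\varphi_v(G)\subseteq G$ for all $v\in X^*$, and self-replicating if moreover $\varphi_v(\operatorname{St}_G(v))=G$ for all $v\in X^*$. Tree-primitivity. The action of $G$ on $X^*$ is tree-primitive if for every $n\in\mathbf{N}$ the only $G$-invariant partitions of $X^n$ are the partitions $\{vX^{n-m}\}_{v\in X^m}$, $0\leq m\leq n$. Subgroup induction property. For $G$ self-replicating, a collection $\mathcal{C}$ of subgroups of $G$ is inductive if (I) $1,G\in\mathcal{C}$; (II) if $H\in\mathcal{C}$ and $L\leq G$ contains $H$ as a finite index subgroup, then $L\in\mathcal{C}$; (III) if $H\leq\operatorname{St}_G(X)$ is finitely generated and $\varphi_x(H)\in\mathcal{C}$ for all $x\in X$, then $H\in\mathcal{C}$. A finitely generated self-replicating group $G$ has the subgroup induction property if every inductive collection of subgroups of $G$ contains all finitely generated subgroups of $G$. Block subgroups. Let $V\subseteq X^*$ be a finite set of pairwise incomparable elements. A subgroup $H\leq G$ is a diagonal block subgroup with supporting vertex set $V$ if (i) $H\leq\operatorname{SRist}_G(V)$; (ii) $\varphi_v(H)$ has finite index in $\varphi_v(\operatorname{St}_G(v))$ for all $v\in V$; (iii) $\varphi_v$ is injective on $H$ for all $v\in V$. If $V=\bigsqcup_{i=1}^bV_i$ is a finite set of pairwise incomparable elements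 partitioned into $b\ge 0$ non-empty subsets, $H\leq G$ is a block subgroup with supporting partition $\{V_i\}_{i=1}^b$ if $H=H_1\cdots H_b$ where each $H_i$ is a diagonal block subgroup with supporting vertex set $V_i$ (the $H_i$ pairwise commute; for $b=0$, i.e. $V=\emptyset$, $H$ is the trivial subgroup). A block subgroup is a subgroup that is a block subgroup with some supporting partition. *)

(* Defs.v *)
From HB Require Import structures.
From mathcomp Require Import all_boot.
From mathcomp Require Import boolp classical_sets functions cardinality.

Set Implicit Arguments.
Unset Strict Implicit.
Unset Printing Implicit Defensive.

Local Open Scope classical_set_scope.
Local Open Scope group_scope.

(* Subgroups of possibly infinite groups are handled as sets of elements. *)
Section Subgroups.
Variable gT : groupType.
Implicit Types (x y : gT) (S H K : set gT).

Definition is_subgroup H := H 1 /\ forall x y, H x -> H y -> H (x / y).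

Definition generated S : set gT := smallest is_subgroup S.

Definition finitely_generated H :=
  exists2 S : set gT, finite_set S & H = generated S.

Definition left_coset H x : set gT := [set x * h | h in H].

Definition finite_index H K :=
  H `<=` K /\ finite_set [set left_coset H x | x in K].

End Subgroups.

Section TreeAutomorphisms.
Variable X : finType.
Implicit Types u v w : seq X.

(* The poset X^* is [seq X] ordered by [prefix].  The inverse is stored
   explicitly; it is determined by the underlying function (see [taut_eq]). *)
Record taut := TAut {
  taut_fun :> seq X -> seq X;
  taut_inv : seq X -> seq X;
  taut_funK : cancel taut_fun taut_inv;
  taut_invK : cancel taut_inv taut_fun;
  taut_mono : {mono taut_fun : u v / prefix u v}
}.

Lemma taut_eq (g h : taut) : g =1 h -> g = h.
Proof.
case: g h => [f f' fK f'K fm] [k k' kK k'K km] /= /funext E; subst k.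
have E : f' = k' by apply/funext => v; rewrite -[in RHS](f'K v) kK.
by subst k'; congr TAut; apply: Prop_irrelevance.
Qed.

HB.instance Definition _ := gen_eqMixin taut.
HB.instance Definition _ := gen_choiceMixin taut.

Lemma taut_invmono (g : taut) : {mono taut_inv g : u v / prefix u v}.
Proof. by move=> u v; rewrite -(taut_mono g) !taut_invK. Qed.

Definition taut_one : taut :=
  @TAut id id (fun=> erefl) (fun=> erefl) (fun _ _ => erefl).

Definition taut_V (g : taut) : taut :=
  TAut (taut_invK g) (taut_funK g) (@taut_invmono g).

Lemma taut_comp_mono (g h : taut) : {mono g \o h : u v / prefix u v}.
Proof. by move=> u v /=; rewrite !taut_mono. Qed.

(* Automorphisms act on the left: (g * h) v = g (h v). *)
Definition taut_mul (g h : taut) : taut :=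
  TAut (can_comp (taut_funK g) (taut_funK h))
       (can_comp (taut_invK h) (taut_invK g)) (@taut_comp_mono g h).

Lemma taut_mulA : associative taut_mul.
Proof. by move=> g h k; apply: taut_eq. Qed.
Lemma taut_mul1 : left_id taut_one taut_mul.
Proof. by move=> g; apply: taut_eq. Qed.
Lemma taut_mulr1 : right_id taut_one taut_mul.
Proof. by move=> g; apply: taut_eq. Qed.
Lemma taut_mulV : left_inverse taut_one taut_V taut_mul.
Proof. by move=> g; apply: taut_eq => v /=; rewrite taut_funK. Qed.
Lemma taut_mulrV : right_inverse taut_one taut_V taut_mul.
Proof. by move=> g; apply: taut_eq => v /=; rewrite taut_invK. Qed.

HB.instance Definition _ := isGroup.Build taut
  taut_mulA taut_mul1 taut_mulr1 taut_mulV taut_mulrV.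

Lemma size_taut_le (g : taut) v : size v <= size (g v).
Proof.
pose p w : seq (seq X) := [seq take i w | i <- iota 0 (size w).+1].
have pP u w : (u \in p w) = prefix u w.
  apply/mapP/prefixP => [[i _ ->]|[s ->]].
    by exists (drop i w); rewrite cat_take_drop.
  exists (size u); last by rewrite take_size_cat.
  by rewrite mem_iota add0n ltnS size_cat leq_addr.
have up w : uniq (p w).
  rewrite map_inj_in_uniq ?iota_uniq // => i j.
  rewrite !mem_iota !add0n !ltnS => /= li lj /(congr1 size).
  by rewrite !size_takel.
have szp w : size (p w) = (size w).+1 by rewrite size_map size_iota.
rewrite -ltnS -!szp -(size_map g); apply: uniq_leq_size.
  by rewrite (map_inj_uniq (can_inj (taut_funK g))).
by move=> _ /mapP[u uv ->]; rewrite pP taut_mono -pP.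
Qed.

Lemma size_taut (g : taut) v : size (g v) = size v.
Proof.
apply/eqP; rewrite eqn_leq size_taut_le andbT.
by rewrite -[X in _ <= size X](taut_funK g v) (size_taut_le (taut_V g)).
Qed.

Lemma taut_cat (g : taut) v w : g (v ++ w) = g v ++ drop (size v) (g (v ++ w)).
Proof.
have /prefixP[s E] : prefix (g v) (g (v ++ w)) by rewrite taut_mono prefix_prefix.
by rewrite E -[in drop _ _](size_taut g v) drop_size_cat.
Qed.

Definition section_fun v (g : taut) w := drop (size v) (g (v ++ w)).

Lemma section_funK v (g : taut) :
  cancel (section_fun v g) (section_fun (g v) (taut_V g)).
Proof.
move=> w; rewrite /section_fun -taut_cat /= taut_funK.
by rewrite size_taut drop_size_cat.
Qed.

Lemma section_invK v (g : taut) :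
  cancel (section_fun (g v) (taut_V g)) (section_fun v g).
Proof.
by move=> w; have := section_funK (g v) (taut_V g) w; rewrite /= taut_funK.
Qed.

Lemma section_mono v (g : taut) : {mono section_fun v g : u w / prefix u w}.
Proof.
have catl (s t r : seq X) : prefix (s ++ t) (s ++ r) = prefix t r.
  by elim: s => //= x s IHs; rewrite eqxx.
move=> u w.
by rewrite -(catl (g v)) -!taut_cat taut_mono catl.
Qed.

Definition tsection v (g : taut) : taut :=
  TAut (@section_funK v g) (@section_invK v g) (@section_mono v g).

Lemma tsectionP v (g : taut) w : g (v ++ w) = g v ++ tsection v g w.
Proof. exact: taut_cat. Qed.

Lemma tsection_unique v (g h : taut) :
  (forall w, g (v ++ w) = g v ++ h w) -> h = tsection v g.
Proof.
move=> hP; apply: taut_eq => w /=.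
by rewrite /section_fun hP -(size_taut g v) drop_size_cat.
Qed.

Definition comparable u v := prefix u v || prefix v u.

Definition level n : set (seq X) := [set v | size v = n].

Implicit Types (G H : set taut) (V : set (seq X)).

Definition Stv G v : set taut := [set g | G g /\ g v = v].

Definition St G V : set taut := [set g | G g /\ forall v, V v -> g v = v].

Definition Ristv G v : set taut :=
  [set g | G g /\ forall w, ~~ prefix v w -> g w = w].

Definition Rist G V : set taut :=
  [set g | G g /\ forall w, (forall v, V v -> ~~ comparable v w) -> g w = w].

Definition SRist G V : set taut := Rist G V `&` St G V.

Definition Rist_level G n : set taut :=
  generated (\bigcup_(v in level n) Ristv G v).

Definition level_transitive G :=
  forall n u v, level n u -> level n v -> exists2 g : taut, G g & g u = v.

Definition branch G :=
  level_transitive G /\ forall n, finite_index (Rist_level G n) G.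

Definition self_similar G :=
  G <> [set 1] /\ forall v, tsection v @` G `<=` G.

Definition self_replicating G :=
  self_similar G /\ forall v, tsection v @` Stv G v = G.

Definition invariant_partition G (P : set (set (seq X))) :=
  forall g : taut, G g -> [set g @` B | B in P] = P.

Definition tree_primitive G :=
  forall n (P : set (set (seq X))),
    partition P id (level n) -> invariant_partition G P ->
    exists2 m, m <= n &
      P = [set [set v ++ w | w in level (n - m)] | v in level m].

Definition inductive_collection G (C : set (set taut)) :=
  [/\ forall H, C H -> is_subgroup H /\ H `<=` G,
      C [set 1] /\ C G,
      forall H L, C H -> is_subgroup L -> L `<=` G -> finite_index H L -> C L
    & forall H, is_subgroup H -> H `<=` St G (level 1) ->
        finitely_generated H ->
        (forall x : X, C (tsection [:: x] @` H)) -> C H].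

Definition subgroup_induction G :=
  forall C, inductive_collection G C ->
  forall H, is_subgroup H -> H `<=` G -> finitely_generated H -> C H.

Definition finite_antichain V :=
  finite_set V /\ forall u v, V u -> V v -> comparable u v -> u = v.

Definition diagonal_block G V H :=
  [/\ is_subgroup H /\ finite_antichain V,
      H `<=` SRist G V,
      forall v, V v -> finite_index (tsection v @` H) (tsection v @` Stv G v)
    & forall v, V v -> set_inj H (tsection v)].

Definition block_with_partition G b (V : 'I_b -> set (seq X)) H :=
  [/\ finite_antichain (\bigcup_i V i),
      partition [set: 'I_b] V (\bigcup_i V i)
    & exists2 K : 'I_b -> set taut, forall i, diagonal_block G (V i) (K i) &
        H = [set \prod_(i < b) h i | h in [set h | forall i, K i (h i)]]].

Definition block_subgroup G H :=
  exists b (V : 'I_b -> set (seq X)), block_with_partition G V H.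

End TreeAutomorphisms.

(* Main.v *)
Require Import Defs.
From mathcomp Require Import all_boot.
From mathcomp Require Import boolp classical_sets functions cardinality.
From mathcomp Require Import zify.
(* [eqtype.comparable] would otherwise hide [Defs.comparable]. *)
Import Defs.

(** By the subgroup induction property, a finitely generated [H] has, up to
finite index, an antichain [V] of vertices which it fixes, off which it acts
trivially, and at which its sections have finite index in [G]; in particular
[G] is a torsion group, so that commutator subgroups of its finite index
subgroups have finite index.

For vertices [a], [b] below [V] let [J a] be the pointwise fixator in [H] of
the subtree at [a], and say that [a] is linked to [b] if [J a] lies in [J b].
A link from [v] to [x'] together with a link from [x'] to a vertex below [v]
matches clopen parts of the boundaries of the two trees, compatibly with [H].
This matching need not be induced by a map of vertices, but it does map small
subtrees to small subtrees: let [N] be the group generated by the elements of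
[G] that move a proportion at most [s] of the words of a long length.  It is
normal in [G], so by tree-primitivity its orbits are the subtrees at some
level.  By transitivity of [H] the matching multiplies proportions by a
constant, and elements of small support lie in the closure of every finite
index subgroup; hence the matching carries such groups on one side to such
groups on the other side, and orbits to orbits.

So all deep vertices are good: in every tree of [V] they are linked to
nothing, or have the same fixator as some vertex.  The minimal good vertices
form an antichain, two of them have either equal fixators or independent ones,
and the classes of equal fixators support the diagonal blocks. *)

Set Implicit Arguments.
Unset Strict Implicit.
Unset Printing Implicit Defensive.
Local Open Scope classical_set_scope.
Local Open Scope group_scope.

(** * Finite index subgroups *)

Section Subgroups.
Variable gT : groupType.
Implicit Types (x y g h : gT) (H K L M : set gT).

(** A link gives no vertex map between two trees, so they are compared through a quantity that needs
    none: the proportion of words moved. Passing from the tree at [v] to the one at [v' ++ q0]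
    divides the bound on this proportion by a density [b / d ^ e], and returning to the subtree at
    [v ++ y] divides it by [b2 / d ^ e2]. The product of the densities is at least [d ^ -size y], so
    a bound [d ^ -n] comes back as [d ^ -(n - size y)], exactly the scale change between a tree and
    its subtree at [y]. This is why a round trip still fixes the vertex [p] it started from. Normal
    subgroups get finite index from a double commutator trick: if [N] moves [u], it contains the
    commutators of elements supported below [u] in a group normalising it. Closures and compactness
    are replaced by conditions on finitely many colours that get stronger with the level and
    therefore stabilise. *)

Lemma sub1 H : is_subgroup H -> H 1. Proof. by case. Qed.
Lemma subV H x : is_subgroup H -> H x -> H x^-1.
Proof. by case=> H1 Hd Hx; rewrite -[_^-1]mul1g; apply: Hd. Qed.
Lemma subM H x y : is_subgroup H -> H x -> H y -> H (x * y).
Proof.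
by move=> sH Hx Hy; rewrite -[y]invgK; apply: sH.2 => //; apply: subV.
Qed.
Lemma subX H x n : is_subgroup H -> H x -> H (x ^+ n).
Proof.
move=> sH Hx; elim: n => [|n IH]; first by rewrite expg0; apply: sub1.
by rewrite expgS; apply: subM.
Qed.
Lemma is_subgroupP H :
  H 1 -> (forall x, H x -> H x^-1) -> (forall x y, H x -> H y -> H (x * y)) ->
  is_subgroup H.
Proof. by move=> H1 HV HM; split=> // x y Hx Hy; apply: HM => //; apply: HV. Qed.
Lemma subgroupI H K : is_subgroup H -> is_subgroup K -> is_subgroup (H `&` K).
Proof.
move=> sH sK; split; first by split; apply: sub1.
by move=> x y [? ?] [? ?]; split; [apply: sH.2|apply: sK.2].
Qed.
Lemma subgroup1 : is_subgroup [set (1 : gT)].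
Proof. by split=> //= x y -> ->; rewrite invg1 mulg1. Qed.

Lemma generated_sub (S : set gT) : S `<=` generated S.
Proof. by move=> x Sx M [_]; apply. Qed.
Lemma generated_min (S : set gT) M : is_subgroup M -> S `<=` M -> generated S `<=` M.
Proof. by move=> sM SM x; apply. Qed.
Lemma generated_subgroup (S : set gT) : is_subgroup (generated S).
Proof.
split=> [M [sM _]|x y gx gy M MP]; first exact: sub1.
by apply: MP.1.2; [apply: gx|apply: gy].
Qed.

(* Finite index as a finite colouring whose classes lie in left cosets; unlike
   [finite_index] it passes to intersections and preimages without choosing
   representatives. *)
Definition fi K H := K `<=` H /\
  exists (C : finType) (c : gT -> C), forall x y, H x -> H y -> c x = c y -> K (x^-1 * y).

Lemma fi_refl H : is_subgroup H -> fi H H.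
Proof.
by move=> sH; split=> //; exists unit, (fun=> tt) => x y Hx Hy _; apply: subM => //; apply: subV.
Qed.

Lemma fi_finite_index K H : is_subgroup K -> fi K H -> finite_index K H.
Proof.
move=> sK [KH [C [c cP]]]; split=> //.
pose r (a : C) : gT := if pselect (exists2 x, H x & c x = a) is left e then sval (cid2 e) else 1.
apply: (@sub_finite_set _ _ ((fun a => left_coset K (r a)) @` [set: C])); last first.
  exact/finite_image/finite_finset.
move=> _ [x Hx <-]; exists (c x) => //.
rewrite /r; case: pselect => [e|[]]; last by exists x.
case: (cid2 e) => y Hy /= yx.
have k : K (y^-1 * x) by apply: cP.
apply/seteqP; split=> _ [h Kh <-].
  exists ((y^-1 * x)^-1 * h); first by apply: subM => //; apply: subV.
  by rewrite invgM invgK !mulgA mulgV mul1g.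
exists (y^-1 * x * h); first exact: subM.
by rewrite !mulgA mulgV mul1g.
Qed.

Lemma finite_index_fi K H : is_subgroup K -> is_subgroup H -> finite_index K H -> fi K H.
Proof.
move=> sK sH [KH fin]; split=> //.
pose r (A : set gT) : gT :=
  if pselect (exists2 x, H x & left_coset K x = A) is left e then sval (cid2 e) else 1.
have /finite_seqP[s Es] := finite_image r fin.
pose P x (t : gT) : bool := `[< K (x^-1 * t) >].
exists 'I_(size s).+1, (fun x => inord (find (P x) s)) => x y Hx Hy E.
have hs z : H z -> has (P z) s.
  move=> Hz; apply/hasP; exists (r (left_coset K z)).
    have : (r @` [set left_coset K x | x in H]) (r (left_coset K z)).
      by exists (left_coset K z) => //; exists z.
    by rewrite Es.
  apply/asboolP; rewrite /r; case: pselect => [e|[]]; last by exists z.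
  case: (cid2 e) => w /= Hw Ew.
  have : left_coset K w w by exists 1; rewrite ?mulg1 //; apply: sub1.
  by rewrite Ew => -[k Kk <-]; rewrite mulKg.
have lt z : (find (P z) s < (size s).+1)%N by rewrite ltnS find_size.
have {}E : find (P x) s = find (P y) s.
  by move/(congr1 val): E; rewrite /= !inordK.
have /asboolP Px := nth_find 1 (hs x Hx).
have /asboolP Py := nth_find 1 (hs y Hy).
rewrite E in Px.
rewrite (_ : x^-1 * y = (x^-1 * nth 1 s (find (P y) s)) * (y^-1 * nth 1 s (find (P y) s))^-1).
  by apply: subM => //; apply: subV.
by rewrite invgM invgK !mulgA mulgK.
Qed.

Lemma fi_trans K L H : is_subgroup L -> fi K L -> fi L H -> fi K H.
Proof.
move=> sL [KL [C [c cP]]] [LH [D [d dP]]]; split; first exact: subset_trans LH.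
pose r (a : D) : gT := if pselect (exists2 x, H x & d x = a) is left e then sval (cid2 e) else 1.
have rP x : H x -> H (r (d x)) /\ d (r (d x)) = d x.
  move=> Hx; rewrite /r; case: pselect => [e|[]]; last by exists x.
  by case: (cid2 e).
(* An element is coloured by [d] and, once moved into [L] by the representative of that colour, by
   [c]. *)
exists (D * C)%type, (fun x => (d x, c ((r (d x))^-1 * x))) => x y Hx Hy [dxy cxy].
have [Hrx drx] := rP x Hx; have [Hry dry] := rP y Hy.
have := cP _ _ (dP _ _ Hrx Hx drx) (dP _ _ Hry Hy dry) cxy.
by rewrite dxy invgM invgK -!mulgA mulVKg.
Qed.

Lemma fi_setIl K L H : is_subgroup L -> L `<=` H -> fi K H -> fi (K `&` L) L.
Proof.
move=> sL LH [KH [C [c cP]]]; split; first by move=> x [].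
exists C, c => x y Lx Ly E; split; first by apply: cP => //; apply: LH.
by apply: subM => //; apply: subV.
Qed.

Lemma fi_setI K L H : fi K H -> fi L H -> fi (K `&` L) H.
Proof.
move=> [KH [C [c cP]]] [LH [D [d dP]]]; split; first by move=> x [/KH].
by exists (C * D)%type, (fun x => (c x, d x)) => x y Hx Hy [? ?]; split; [apply: cP|apply: dP].
Qed.

Lemma fi_between K L H : K `<=` L -> L `<=` H -> fi K H -> fi L H.
Proof.
move=> KL LH [_ [C [c cP]]]; split=> //; exists C, c => x y Hx Hy E.
by apply: KL; apply: cP.
Qed.

Lemma fi_bigI (I : eqType) (s : seq I) (K : I -> set gT) H : is_subgroup H ->
  (forall i, i \in s -> fi (K i) H) ->
  fi [set x | H x /\ forall i, i \in s -> K i x] H.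
Proof.
move=> sH; elim: s => [|i s IH] Ks.
  by apply: fi_between (fi_refl sH) => x // [].
have Ks' j : j \in s -> fi (K j) H by move=> js; apply: Ks; rewrite inE js orbT.
apply: fi_between (fi_setI (Ks i (mem_head i s)) (IH Ks')).
  by move=> x [Kx [Hx Kjx]]; split=> // j; rewrite inE => /orP[/eqP->//|]; apply: Kjx.
by move=> x [].
Qed.

Definition fg H := exists s : seq gT, H = generated [set` s].

Lemma fgP H : finitely_generated H -> fg H.
Proof. by case=> S /finite_seqP[s ->] ->; exists s. Qed.

(* Schreier: right cosets of [L] have the representatives [tau x]; since a
   colour class may be smaller than a coset, the representatives lying in [L]
   are added to the Schreier generators. *)
Lemma fg_fi L A : is_subgroup L -> fi L A -> fg A -> fg L.
Proof.
move=> sL [LA [C [c cP]]] [s sE].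
have sA : is_subgroup A by rewrite sE; apply: generated_subgroup.
pose r (a : C) : gT :=
  if pselect (exists2 x, A x & c x^-1 = a) is left e then sval (cid2 e) else 1.
(* Equal colours bound left cosets; inverting first makes [tau x] a representative of a right
   coset. *)
pose tau x := r (c x^-1).
have tauA a : A (r a).
  by rewrite /r; case: pselect => [e|_]; [case: (cid2 e)|apply: sub1].
have tauL x : A x -> L (x * (tau x)^-1).
  move=> Ax; rewrite /tau /r; case: pselect => [e|[]]; last by exists x.
  case: (cid2 e) => y /= Ay Ey; rewrite -[x in x * _]invgK.
  by apply: cP => //; apply: subV.
pose T := [seq r a | a <- enum C].
have tauT x : tau x \in T by apply: map_f; rewrite mem_enum.
pose S := s ++ [seq x^-1 | x <- s].
have SA x : x \in S -> A x.
  rewrite mem_cat => /orP[xs|/mapP[y ys ->]].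
    by rewrite sE; apply: generated_sub.
  by apply: subV => //; rewrite sE; apply: generated_sub.
pose g := [seq t * x * (tau (t * x))^-1 | t <- T, x <- S] ++ [seq t <- T | `[< L t >]].
exists g; apply/seteqP; split; last first.
  apply: generated_min => // x /=; rewrite mem_cat => /orP[/allpairsP[[t y] /= [tT yS ->]]|].
    apply: tauL; apply: subM => //; last exact: SA.
    by case/mapP: tT => a _ ->.
  by rewrite mem_filter => /andP[/asboolP].
pose L1 := generated [set` g].
have sL1 : is_subgroup L1 by apply: generated_subgroup.
(* [U] is the product [L1 T]. It contains 1 and is stable under right multiplication by the
   generators of [A] and their inverses, so it contains all of [A]. *)
pose U := [set x | exists2 l, L1 l & exists2 t, t \in T & x = l * t].
have US u x : U u -> x \in S -> U (u * x).
  move=> [l L1l [t tT ->]] xS.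
  exists (l * (t * x * (tau (t * x))^-1)).
    apply: (subM sL1 L1l); apply: generated_sub => /=; rewrite mem_cat.
    by apply/orP; left; apply/allpairsP; exists (t, x).
  by exists (tau (t * x)) => //; rewrite -!mulgA mulVg mulg1.
pose M := [set x | (forall u, U u -> U (u * x)) /\ (forall u, U u -> U (u * x^-1))].
have sM : is_subgroup M.
  apply: is_subgroupP => /=.
  - by split=> u; rewrite ?invg1 mulg1.
  - by move=> x [? ?]; rewrite /M /= invgK.
  - move=> x y [x1 x2] [y1 y2]; split=> u Uu; first by rewrite mulgA; apply/y1/x1.
    by rewrite invgM mulgA; apply/x2/y2.
have AM : A `<=` M.
  rewrite sE; apply: generated_min => // x /= xs; split=> u Uu; apply: US => //.
    by rewrite mem_cat xs.
  by rewrite mem_cat map_f ?orbT.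
have L1T t : t \in T -> L t -> L1 t.
  move=> tT Lt; apply: generated_sub; rewrite /= mem_cat mem_filter tT andbT.
  by apply/orP; right; apply/asboolP.
have U1 : U 1.
  exists (tau 1)^-1; last by exists (tau 1); rewrite ?mulVg.
  apply: (subV sL1); apply: L1T => //; rewrite -[tau 1]invgK; apply: subV => //.
  by rewrite -[X in L X]mul1g; apply: tauL; apply: sub1.
have L1L : L1 `<=` L.
  apply: generated_min => // x /=; rewrite mem_cat => /orP[/allpairsP[[t y] /= [tT yS ->]]|].
    apply: tauL; apply: subM => //; last exact: SA.
    by case/mapP: tT => a _ ->.
  by rewrite mem_filter => /andP[/asboolP].
move=> l Ll; have [m L1m [t tT E]] : U l by rewrite -[l]mul1g; apply: (AM l (LA _ Ll)).1.
rewrite E; apply: (subM sL1) => //; apply: L1T => //.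
rewrite -[t](mulKg m) -E; apply: subM => //; apply: subV => //; exact: L1L.
Qed.

Definition comm x y := x * y * x^-1 * y^-1.

Lemma comm_eq1 x y : comm x y = 1 -> x * y = y * x.
Proof. by move=> /divg1_eq E; rewrite -{2}E mulgVK. Qed.

(** [D] is normal in [A] with abelian quotient, so the cosets of [D] by powers of [x] already form a
    subgroup, and there are finitely many of them. *)
Lemma fi_adjoin A D x : is_subgroup A -> is_subgroup D -> D `<=` A ->
  (forall a b, A a -> A b -> D (comm a b)) -> A x ->
  (exists2 n, (0 < n)%N & x ^+ n = 1) ->
  exists E, [/\ is_subgroup E, E `<=` A, D `<=` E, E x & fi D E].
Proof.
move=> sA sD DA cD Ax [n n0 xn].
have nD a d : A a -> D d -> D (a * d * a^-1).
  move=> Aa Dd; rewrite -[_ * _]mulg1 -(mulVg d) mulgA; apply: subM => //.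
  by apply: cD => //; apply: DA.
have modn e : x ^+ e = x ^+ (e %% n).
  by rewrite {1}(divn_eq e n) expgnDr mulnC expgnA xn expg1n mul1g.
pose E := [set y | exists2 e, (e < n)%N & D ((x ^+ e)^-1 * y)].
have inE' e y : D ((x ^+ e)^-1 * y) -> E y.
  by rewrite modn; exists (e %% n)%N; rewrite ?ltn_mod.
have XA e : A (x ^+ e) by apply: subX.
have xV e : (e <= n)%N -> (x ^+ e)^-1 = x ^+ (n - e).
  by move=> en; apply: (mulIg (x ^+ e)); rewrite mulVg -expgnDr subnK.
have EA : E `<=` A.
  move=> y [e _ /DA Ay]; rewrite -[y](mulVKg (x ^+ e)); exact: subM.
exists E; split=> //.
- apply: is_subgroupP.
  + by apply: (inE' 0%N); rewrite expg0 invg1 mulg1; apply: sub1.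
  + move=> y [e en Dy]; apply: (inE' (n - e)%N).
    rewrite -xV ?(ltnW en) // invgK.
    have -> : x ^+ e * y^-1 = x ^+ e * ((x ^+ e)^-1 * y)^-1 * (x ^+ e)^-1.
      by rewrite invgM invgK !mulgA mulgK.
    by apply: nD => //; apply: subV.
  + move=> y z [e en Dy] [f fn Dz]; apply: (inE' (e + f)%N).
    rewrite addnC expgnDr invgM.
    have -> : (x ^+ e)^-1 * (x ^+ f)^-1 * (y * z) = 
      (x ^+ f)^-1 * ((x ^+ e)^-1 * y) * x ^+ f * ((x ^+ f)^-1 * z).
      rewrite -[_^-1 * _^-1]invgM -expgnDr addnC expgnDr invgM !mulgA.
      by rewrite -(mulgA _ (x ^+ f) (x^+f)^-1) mulgV mulg1.
    apply: subM => //; rewrite -[X in _ * X]invgK; apply: nD => //; exact: subV.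
- by move=> d Dd; apply: (inE' 0%N); rewrite expg0 invg1 mul1g.
- by apply: (inE' 1%N); rewrite expg1 mulVg; apply: sub1.
- split; first by move=> d Dd; apply: (inE' 0%N); rewrite expg0 invg1 mul1g.
  pose c y : 'I_n.+1 := if pselect (E y) is left e then inord (sval (cid2 e)) else ord0.
  exists 'I_n.+1, c => y z Ey Ez; rewrite /c.
  case: pselect => // {}Ey; case: pselect => // {}Ez.
  case: (cid2 Ey) => e en Dy /=; case: (cid2 Ez) => f fn Dz /= /(congr1 val) /=.
  rewrite !inordK ?ltnS ?(ltnW en) ?(ltnW fn) // => ef; subst f.
  rewrite (_ : y^-1 * z = ((x ^+ e)^-1 * y)^-1 * ((x ^+ e)^-1 * z)).
    by apply: subM => //; apply: subV.
  by rewrite invgM invgK -!mulgA mulVKg.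
Qed.

(** A finitely generated abelian torsion group is finite: the generators of [A] are adjoined to [D]
    one at a time. *)
Lemma fi_comm A D : is_subgroup A -> fg A -> is_subgroup D -> D `<=` A ->
  (forall a b, A a -> A b -> D (comm a b)) ->
  (forall x, A x -> exists2 n, (0 < n)%N & x ^+ n = 1) -> fi D A.
Proof.
move=> sA [s sE] sD DA cD tor.
have : forall x, x \in s -> A x by move=> x xs; rewrite sE; apply: generated_sub.
have [E [sE' EA DE FE SE]] : exists E, [/\ is_subgroup E, E `<=` A, D `<=` E, fi D E
    & forall x, x \in s -> A x -> E x].
  elim: s {sE} => [|x s [E [sE' EA DE FE SE]]].
    by exists D; split=> //; apply: fi_refl.
  have [Ax|nAx] := pselect (A x); last first.
    by exists E; split=> // y; rewrite inE => /orP[/eqP->|]; [|apply: SE].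
  have [F [sF FA EF Fx fiEF]] := fi_adjoin sA sE' EA (fun a b Aa Ab => DE _ (cD a b Aa Ab))
    Ax (tor _ Ax).
  exists F; split=> //; [exact: subset_trans EF|exact: fi_trans fiEF|].
  by move=> y; rewrite inE => /orP[/eqP->//|ys Ay]; apply/EF/SE.
move=> sA'; suff <- : E = A by [].
apply/seteqP; split=> //; rewrite [X in X `<=` _]sE; apply: generated_min => // x xs.
by apply: SE => //; apply: sA'.
Qed.

End Subgroups.

Section Morphism.
Variables (gT rT : groupType) (f : gT -> rT).
Implicit Types (H K L : set gT).

(** Multiplicativity is relative to [H] because taking sections at [v] is a homomorphism only on
    elements fixing [v]. *)
Definition morph_on H := forall x y, H x -> H y -> f (x * y) = f x * f y.

Lemma morph1 H : is_subgroup H -> morph_on H -> f 1 = 1.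
Proof.
move=> sH fM; have := fM 1 1 (sub1 sH) (sub1 sH); rewrite mulg1 => E.
by apply: (mulgI (f 1)); rewrite mulg1.
Qed.

Lemma morphV H x : is_subgroup H -> morph_on H -> H x -> f x^-1 = (f x)^-1.
Proof.
move=> sH fM Hx; apply: (mulgI (f x)); rewrite -fM ?mulgV ?(morph1 sH fM) //.
exact: subV.
Qed.

Lemma image_subgroup H : is_subgroup H -> morph_on H -> is_subgroup (f @` H).
Proof.
move=> sH fM; split; first by exists 1; [apply: sub1|apply: morph1 sH fM].
move=> _ _ [x Hx <-] [y Hy <-]; exists (x * y^-1); first exact: sH.2.
by rewrite fM ?(morphV sH fM) //; apply: subV.
Qed.

Lemma preimage_subgroup H (S : set rT) : is_subgroup H -> morph_on H -> is_subgroup S ->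
  is_subgroup [set x | H x /\ S (f x)].
Proof.
move=> sH fM sS; apply: is_subgroupP => [|x [Hx Sx]|x y [Hx Sx] [Hy Sy]]; split.
- exact: sub1.
- by rewrite (morph1 sH fM); apply: sub1.
- exact: subV.
- by rewrite (morphV sH fM) //; apply: subV.
- exact: subM.
- by rewrite fM //; apply: subM.
Qed.

Lemma fi_image K H : is_subgroup H -> morph_on H -> fi K H -> fi (f @` K) (f @` H).
Proof.
move=> sH fM [KH [C [c cP]]]; split; first exact: image_subset.
pose r (y : rT) : gT :=
  if pselect (exists2 x, H x & f x = y) is left e then sval (cid2 e) else 1.
have rP y : (f @` H) y -> H (r y) /\ f (r y) = y.
  by move=> [x Hx <-]; rewrite /r; case: pselect => [e|[]]; [case: (cid2 e)|exists x].
exists C, (c \o r) => x y /rP[Hx fx] /rP[Hy fy] /= E.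
exists ((r x)^-1 * r y); first exact: cP.
by rewrite fM ?(morphV sH fM) ?fx ?fy //; apply: subV.
Qed.

Lemma fi_preimage (K L : set rT) H : is_subgroup H -> morph_on H ->
  f @` H `<=` L -> fi K L -> fi [set x | H x /\ K (f x)] H.
Proof.
move=> sH fM HL [KL [C [c cP]]]; split; first by move=> x [].
exists C, (c \o f) => x y Hx Hy /= E; split; first by apply: subM => //; apply: subV.
rewrite fM ?(morphV sH fM) //; last exact: subV.
by apply: cP => //; apply: HL; [exists x|exists y].
Qed.

Lemma fg_image H : is_subgroup H -> morph_on H -> fg H -> fg (f @` H).
Proof.
move=> sH fM [s sE]; exists [seq f x | x <- s].
have sfH := image_subgroup sH fM.
apply/seteqP; split; last first.
  apply: generated_min => // _ /= /mapP[x xs ->]; exists x => //.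
  by rewrite sE; apply: generated_sub.
pose M := [set x | H x /\ generated [set` [seq f x | x <- s]] (f x)].
have sG := @generated_subgroup _ [set` [seq f x | x <- s]].
have sM : is_subgroup M.
  apply: is_subgroupP.
  - by split; [apply: sub1|rewrite (morph1 sH fM); apply: sub1].
  - by move=> x [Hx gx]; split; [apply: subV|rewrite (morphV sH fM)//; apply: (subV sG)].
  - by move=> x y [Hx gx] [Hy gy]; split; [apply: subM|rewrite fM//; apply: (subM sG)].
suff HM : H `<=` M by move=> _ [x /HM[_ gx] <-].
rewrite [X in X `<=` _]sE; apply: generated_min => // x /= xs; split.
  by rewrite sE; apply: generated_sub.
by apply: generated_sub; apply: map_f.
Qed.

End Morphism.

(** * Automorphisms of the tree *)

Section Words.
Variable X : eqType.
Implicit Types u v w z : seq X.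

Lemma prefix_cat2l u v w : prefix (u ++ v) (u ++ w) = prefix v w.
Proof. by elim: u => //= x u IHu; rewrite eqxx. Qed.

Lemma prefix_size_eq u v : prefix u v -> size v <= size u -> u = v.
Proof.
move=> /prefixP[w ->]; rewrite size_cat -[leqRHS]addn0 leq_add2l leqn0 size_eq0.
by move=> /eqP->; rewrite cats0.
Qed.

Lemma prefix_drop u v : prefix u v -> u ++ drop (size u) v = v.
Proof. by move=> /prefixP[w ->]; rewrite drop_size_cat. Qed.

Lemma prefix_comparable u v w : prefix u w -> prefix v w -> prefix u v || prefix v u.
Proof.
rewrite !prefixE => /eqP uw /eqP vw.
case: (leqP (size u) (size v)) => s; apply/orP; [left|right].
  by rewrite -vw take_takel // uw.
by rewrite -uw take_takel ?vw // ltnW.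
Qed.

Lemma prefix_le u v w : prefix u w -> prefix v w -> size u <= size v -> prefix u v.
Proof.
move=> uw vw s; case/orP: (prefix_comparable uw vw) => // vu.
by rewrite (prefix_size_eq vu s) prefix_refl.
Qed.

Lemma prefix_take_le n w : prefix (take n w) w.
Proof. by apply/prefixP; exists (drop n w); rewrite cat_take_drop. Qed.

Lemma prefix_eqsize u v w : prefix u w -> prefix v w -> size u = size v -> u = v.
Proof. by move=> uw vw e; apply: prefix_size_eq; rewrite ?e // (prefix_le uw vw) ?e. Qed.

End Words.

Section Tree.
Variable X : finType.
Implicit Types (u v w z y : seq X) (g h r s : taut X) (G H K L : set (taut X)).

Lemma tautM g h w : (g * h) w = g (h w). Proof. by []. Qed.
Lemma taut1 w : (1 : taut X) w = w. Proof. by []. Qed.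
Lemma tautK g w : g^-1 (g w) = w. Proof. exact: taut_funK. Qed.
Lemma tautVK g w : g (g^-1 w) = w. Proof. exact: taut_invK. Qed.
Lemma taut_inj g : injective g. Proof. exact: can_inj (taut_funK g). Qed.

Lemma tautV_fix g w : g w = w -> g^-1 w = w.
Proof. by move=> gw; rewrite -{1}gw tautK. Qed.

Lemma taut_fix_prefix g u w : g (u ++ w) = u ++ w -> g u = u.
Proof.
rewrite taut_cat => /(congr1 (take (size u))).
by rewrite take_size_cat ?size_taut // take_size_cat.
Qed.

Lemma taut_take g v w : take (size v) (g (v ++ w)) = g v.
Proof. by rewrite tsectionP take_size_cat ?size_taut. Qed.

Lemma taut_prefix g u w : prefix (g u) (g w) = prefix u w.
Proof. exact: taut_mono. Qed.

Lemma tsection_eq g v w : g v = v -> g (v ++ w) = v ++ tsection v g w.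
Proof. by move=> gv; rewrite tsectionP gv. Qed.

Lemma catI u : injective (cat u).
Proof. by move=> v w /(congr1 (drop (size u))); rewrite !drop_size_cat. Qed.

Lemma tsectionM v g h : tsection v (g * h) = tsection (h v) g * tsection v h.
Proof.
apply/esym/tsection_unique => w; rewrite !tautM (tsectionP v h) (tsectionP (h v) g) //.
Qed.

Lemma tsectionMfix v g h : h v = v -> tsection v (g * h) = tsection v g * tsection v h.
Proof. by move=> hv; rewrite tsectionM hv. Qed.

Lemma tsection_morph v H : (forall g, H g -> g v = v) -> morph_on (tsection v) H.
Proof. by move=> Hv g h _ Hh; apply: tsectionMfix; apply: Hv. Qed.

Lemma tsection_cat u w g : tsection (u ++ w) g = tsection w (tsection u g).
Proof.
apply/esym/tsection_unique => z; rewrite -catA !(tsectionP u g)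
  -catA. congr (_ ++ _). exact: tsectionP.
Qed.

Lemma tsection_nil g : tsection [::] g = g.
Proof. by apply/taut_eq => w; rewrite /= /section_fun drop0. Qed.

Definition Fix w : set (taut X) := [set g | forall z, g (w ++ z) = w ++ z].
Definition Sup w : set (taut X) := [set g | forall z, ~~ prefix w z -> g z = z].

Lemma Fix_subgroup w : is_subgroup (Fix w).
Proof.
apply: is_subgroupP => //=; first by move=> g gw z; apply: tautV_fix.
by move=> g h gw hw z; rewrite ?tautM hw gw.
Qed.

Lemma Sup_subgroup w : is_subgroup (Sup w).
Proof.
apply: is_subgroupP => //=; first by move=> g gw z wz; apply/tautV_fix/gw.
by move=> g h gw hw z wz; rewrite ?tautM hw // gw.
Qed.

Lemma stab_subgroup w : is_subgroup [set g : taut X | g w = w].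
Proof.
apply: is_subgroupP => //=; first by move=> g gw; apply: tautV_fix.
by move=> g h gw hw; rewrite ?tautM hw gw.
Qed.

Lemma FixE w g : Fix w g <-> g w = w /\ tsection w g = 1.
Proof.
split=> [gw|[gw g1] z]; last by rewrite tsection_eq // g1.
have e : g w = w by rewrite -[w in LHS]cats0 gw cats0.
by split=> //; apply/taut_eq => z; apply: (@catI w); rewrite -tsection_eq ?gw.
Qed.

Lemma Fix_prefix w z g : prefix w z -> Fix w g -> Fix z g.
Proof. by move=> /prefixP[y ->] gw t; rewrite -catA gw. Qed.

Lemma Sup_self w g : Sup w g -> g w = w.
Proof.
move=> gw; case: (boolP (prefix w (g w))) => [p|/gw e]; last exact: (@taut_inj g).
by apply/esym/prefix_size_eq; rewrite ?size_taut.
Qed.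

Lemma Sup_prefix w z : prefix w z -> Sup z `<=` Sup w.
Proof.
by move=> wz g gz t wt; apply: gz; apply: contra wt; apply: prefix_trans.
Qed.

Lemma Sup_conj w g r : Sup w r -> Sup (g w) (g * r * g^-1).
Proof.
move=> rw z wz; rewrite !tautM rw ?tautVK //.
by rewrite -(taut_prefix g) tautVK.
Qed.

Lemma Fix_conj w g r : Fix w r -> Fix (g w) (g * r * g^-1).
Proof.
move=> rw z.
have e : g^-1 (g w ++ z) = w ++ tsection (g w) g^-1 z by rewrite tsectionP tautK.
by rewrite !tautM e rw -e tautVK.
Qed.

Lemma Sup_Fix_incomparable u w r : ~~ comparable u w -> Sup u r -> Fix w r.
Proof.
rewrite negb_or => /andP[uw wu] ru z; apply: ru; apply/negP => uz.
by have := prefix_comparable uz (prefix_prefix w z); rewrite (negPf uw) (negPf wu).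
Qed.

Lemma comparableC u w : comparable u w = comparable w u.
Proof. by rewrite /comparable orbC. Qed.

Lemma Sup_commute u w r s : ~~ comparable u w -> Sup u r -> Sup w s -> r * s = s * r.
Proof.
move=> uw ru sw; apply/taut_eq => z; rewrite !tautM.
have rw := Sup_Fix_incomparable uw ru.
have su : Fix u s by apply: Sup_Fix_incomparable sw; rewrite comparableC.
case: (boolP (prefix u z)) => [uz|uz].
  rewrite -(prefix_drop uz) su tsection_eq ?su //; exact: Sup_self.
rewrite (ru z) //; case: (boolP (prefix w z)) => [wz|wz]; last by rewrite sw // ru.
by rewrite -(prefix_drop wz) tsection_eq ?rw //; exact: Sup_self.
Qed.

Lemma Sup_Fix1 w r : Sup w r -> Fix w r -> r = 1.
Proof.
move=> rs rf; apply/taut_eq => z; case: (boolP (prefix w z)) => [p|/rs//].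
by rewrite -(prefix_drop p) rf.
Qed.

Lemma Sup_moves w r : Sup w r -> r <> 1 -> exists z, r (w ++ z) <> w ++ z.
Proof.
move=> rw r1; apply: contrapT => /forallNP F; apply: r1; apply: (Sup_Fix1 rw) => z.
by apply: contrapT; apply: F.
Qed.

Lemma eqsize_incomparable u w : size u = size w -> u <> w -> ~~ comparable u w.
Proof.
move=> s uw; apply/negP => /orP[] p; apply: uw; last apply/esym.
  by apply: prefix_size_eq; rewrite ?s.
by apply: prefix_size_eq; rewrite ?s.
Qed.

Lemma moved_incomparable g w : g w <> w -> ~~ comparable (g w) w.
Proof. by move=> gw; apply: eqsize_incomparable; rewrite ?size_taut. Qed.


Definition graft_fun y (s : seq X -> seq X) w :=
  if prefix y w then y ++ s (drop (size y) w) else w.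

Lemma graft_funK y (f g : seq X -> seq X) : cancel f g -> cancel (graft_fun y f) (graft_fun y g).
Proof.
move=> fK w; rewrite /graft_fun; case: (boolP (prefix y w)) => p; last by rewrite (negPf p).
by rewrite prefix_prefix drop_size_cat // fK prefix_drop.
Qed.

Lemma graft_mono y s : {mono graft_fun y s : u w / prefix u w}.
Proof.
move=> u w; rewrite /graft_fun.
case: (boolP (prefix y u)) => pu; case: (boolP (prefix y w)) => pw //.
- by rewrite prefix_cat2l taut_prefix -(prefix_cat2l y) !prefix_drop.
- have n1 : prefix (y ++ s (drop (size y) u)) w = false.
    apply/negP => p; case/negP: pw; apply: prefix_trans p; exact: prefix_prefix.
  by rewrite n1; apply/esym/negP => p; case/negP: pw; apply: prefix_trans p.
- apply/idP/idP => p.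
    have/orP[uy|yu] := prefix_comparable p (prefix_prefix y _); last by rewrite yu in pu.
    exact: prefix_trans pw.
  have/orP[uy|yu] := prefix_comparable p pw; last by rewrite yu in pu.
  by apply: prefix_trans uy _; apply: prefix_prefix.
Qed.

Definition graft y s : taut X :=
  TAut (@graft_funK y _ _ (taut_funK s)) (@graft_funK y _ _ (taut_invK s)) (@graft_mono y s).

Lemma graft_cat y s w : graft y s (y ++ w) = y ++ s w.
Proof. by rewrite /= /graft_fun prefix_prefix drop_size_cat. Qed.

Lemma graft_Sup y s : Sup y (graft y s).
Proof. by move=> z /negPf yz; rewrite /= /graft_fun yz. Qed.



Lemma tsection_graft y s : tsection y (graft y s) = s.
Proof.
apply/taut_eq => w; apply: (@catI y); rewrite -tsection_eq ?graft_cat //.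
exact/Sup_self/graft_Sup.
Qed.

Lemma graft_tsection y g : Sup y g -> graft y (tsection y g) = g.
Proof.
move=> gy; apply/taut_eq => w; case: (boolP (prefix y w)) => [p|p].
  by rewrite -(prefix_drop p) graft_cat -tsection_eq //; apply: Sup_self.
by rewrite gy // graft_Sup.
Qed.

Lemma graftM y r s : graft y (r * s) = graft y r * graft y s.
Proof.
apply/taut_eq => w; rewrite tautM; case: (boolP (prefix y w)) => p.
  by rewrite -(prefix_drop p) !graft_cat.
by rewrite !graft_Sup.
Qed.

(** In general this leaves [G]; for elements of [Rist_level G n] and [y] of length [n] it stays
    inside, by [Rist_level_restr]. *)
Definition restr y g := graft y (tsection y g).



Lemma restr_morph y H : (forall g, H g -> g y = y) -> morph_on (restr y) H.
Proof. by move=> Hy g h Hg Hh; rewrite /restr tsectionMfix ?graftM //; apply: Hy. Qed.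

Lemma restr_cat y g w : g y = y -> restr y g (y ++ w) = g (y ++ w).
Proof. by move=> gy; rewrite graft_cat -tsection_eq. Qed.

Lemma restr_Sup y g : Sup y (restr y g).
Proof. exact: graft_Sup. Qed.

Definition words n : seq (seq X) := [seq val t | t <- enum {: n.-tuple X}].

Lemma mem_words n w : (w \in words n) = (size w == n).
Proof.
apply/mapP/eqP => [[t _ ->]|s]; first by rewrite size_tuple.
have t : size w == n by apply/eqP.
by exists (Tuple t); rewrite ?mem_enum.
Qed.

Lemma words_uniq n : uniq (words n).
Proof. by rewrite map_inj_uniq ?enum_uniq //; apply: val_inj. Qed.

End Tree.

(** * Branch groups *)

(** Finite substitute for compactness: a [P i] that fails somewhere fails from then on, and the
    maximum over [I] of such levels decides all of them. *)
Lemma antitone_stable (I : finType) (P : I -> nat -> Prop) :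
  (forall i k, P i k.+1 -> P i k) -> exists m, forall i, P i m -> forall k, P i k.
Proof.
move=> anti.
have le i k l : k <= l -> P i l -> P i k.
  by move=> /subnK <-; elim: (l - k) => // n IH /anti.
pose N i := if pselect (exists k, ~ P i k) is left e then sval (cid e) else 0.
exists (\max_i N i) => i Pi k; apply: contrapT => nP.
have : N i <= \max_i N i by apply: leq_bigmax.
rewrite {1}/N; case: pselect => [e|[]]; last by exists k.
by case: (cid e) => l /= nl ln; apply: nl; apply: le Pi.
Qed.

Lemma choose_bound (T : eqType) (s : seq T) (P : T -> nat -> Prop) :
  (forall x, x \in s -> exists n, forall k, n <= k -> P x k) ->
  exists n, forall x, x \in s -> forall k, n <= k -> P x k.
Proof.
elim: s => [|x s IH] H; first by exists 0.
have [n nP] := H x (mem_head x s).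
have [|m mP] := IH; first by move=> y ys; apply: H; rewrite inE ys orbT.
exists (maxn n m) => y; rewrite inE => /orP[/eqP->|ys] k; rewrite geq_max => /andP[? ?].
  exact: nP.
exact: mP.
Qed.

Section Tree.
Variable X : finType.
Implicit Types (u v w z y t : seq X) (g h r s : taut X) (H K L N : set (taut X)).

Definition agree k g h := forall w, size w = k -> g w = h w.

Lemma agree_le (x0 : X) k j g h : agree k g h -> j <= k -> agree j g h.
Proof.
move=> gh jk w sw.
have E : g (w ++ nseq (k - j) x0) = h (w ++ nseq (k - j) x0).
  by apply: gh; rewrite size_cat size_nseq sw subnKC.
by rewrite -(taut_take g w (nseq (k - j) x0)) E taut_take.
Qed.

Definition fixlev m g := agree m g 1.

Lemma fixlev_subgroup m : is_subgroup (fixlev m).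
Proof.
apply: is_subgroupP => //.
  by move=> g gw z sz; apply: tautV_fix; apply: gw.
by move=> g h gw hw z sz; rewrite tautM hw // gw.
Qed.

Definition normalises L N := forall x n, L x -> N n -> N (x * n * x^-1).

(** Double commutator trick. The conjugate of [a^-1] by [j] lives below [j u], away from [b]. Hence
    the commutator of [j] and [a^-1], an element of [N], has the same commutator with [b] as [a]
    has. *)
Lemma comm_incomparable N L u j a b : is_subgroup N -> is_subgroup L -> normalises L N ->
  N j -> j u <> u -> L a -> L b -> Sup u a -> Sup u b -> N (comm a b).
Proof.
move=> sN sL nN Nj ju La Lb Sa Sb.
have [c Ea] : exists c, a = c^-1 by exists a^-1; rewrite invgK.
have Lc : L c by rewrite -[c]invgK -Ea; apply: subV.
have Sc : Sup u c by rewrite -[c]invgK -Ea; apply: (subV (Sup_subgroup u)).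
have [c' Ec'] : exists c', c' = j * c * j^-1 by eexists.
have Sc' : Sup (j u) c' by rewrite Ec'; apply: Sup_conj.
have i := moved_incomparable ju.
have Nn : N (c' * c^-1).
  rewrite Ec' -!mulgA (mulgA c); apply: subM => //.
  by apply: nN => //; apply: subV.
have Nnb : N (comm (c' * c^-1) b).
  have -> : comm (c' * c^-1) b = (c' * c^-1) * (b * (c' * c^-1)^-1 * b^-1).
    by rewrite /comm !mulgA.
  by apply: subM => //; apply: nN => //; apply: subV.
suff -> : comm a b = comm (c' * c^-1) b by [].
rewrite /comm Ea !(invgM, invgK).
have Cc : c' * c = c * c' by apply: Sup_commute i Sc' Sc.
have Cb : c' * b = b * c' by apply: Sup_commute i Sc' Sb.
have CV : c' * c^-1 = c^-1 * c' by apply: (mulgI c); rewrite mulgA -Cc mulgK mulVKg.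
have -> : c' * c^-1 * b = c^-1 * b * c' by rewrite CV -mulgA Cb mulgA.
have E : c' * (c * c'^-1) = c by rewrite mulgA Cc mulgK.
by rewrite -(mulgA _ c' (c * _)) E.
Qed.

Section Group.
Variable G : set (taut X).
Hypotheses (sG : is_subgroup G) (ntG : G <> [set 1]) (trG : level_transitive G).
Hypothesis ristG : forall n, fi (Rist_level G n) G.

Lemma two_letters : exists x0 x1 : X, x0 <> x1.
Proof.
apply: contrapT => n2; apply: ntG; apply/seteqP; split; last by move=> _ ->; apply: sub1.
have eqX (x y : X) : x = y by apply: contrapT => xy; apply: n2; exists x, y.
move=> g _ /=; apply/taut_eq => w /=; have := size_taut g w.
move: (g w) => s; elim: s w => [|x s IH] [|y t] //= [/IH ->]; congr cons; exact: eqX.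
Qed.

Definition below_trans L w := forall t t', size t = size t' -> exists2 l, L l & l (w ++ t)
  = w ++ t'.

(** For two colours, ask whether elements of [G] with these colours send [o k] into one [L]-orbit.
    This gets stronger with [k], so it is decided at some level [m]; there it holds with [l = 1] as
    soon as both images of [o k] extend the same [w] of length [m]. *)
Lemma fi_below_trans L : is_subgroup L -> fi L G ->
  exists m, forall w, m <= size w -> below_trans L w.
Proof.
move=> sL [LG [C [c cP]]]; have [x0 _] := two_letters.
pose o k := nseq k x0.
pose P (a : C * C) k := exists g1 g2, [/\ G g1, G g2, c g1^-1 = a.1, c g2^-1 = a.2 &
  exists2 l, L l & l (g1 (o k)) = g2 (o k)].
have oD i j : o (i + j)%N = o i ++ o j by rewrite /o nseqD.
have cL g1 g2 : G g1 -> G g2 -> c g1^-1 = c g2^-1 -> L (g1 * g2^-1).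
  by move=> G1 G2 E; rewrite -{1}[g1]invgK; apply: cP E; apply: subV.
have [m mP] : exists m, forall a, P a m -> forall k, P a k.
  apply: antitone_stable => a k [g1 [g2 [G1 G2 c1 c2 [l Ll E]]]].
  exists g1, g2; split=> //; exists l => //; move: E.
  rewrite -addn1 oD !tsectionP => /(congr1 (take k)).
  by rewrite !take_size_cat // !size_taut size_nseq.
suff main w : size w = m -> below_trans L w.
  exists m => w mw t t' tt'; rewrite -(cat_take_drop m w) -!catA; apply: main.
    by rewrite size_takel.
  by rewrite !size_cat tt'.
move=> sw t t' tt'; pose k := size (w ++ t).
have [g1 G1 E1] : exists2 g, G g & g (o k) = w ++ t by apply: (@trG k);
  rewrite /level /= ?size_nseq.
have [g2 G2 E2] : exists2 g, G g & g (o k) = w ++ t'.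
  by apply: (@trG k); rewrite /level /= ?size_nseq // /k !size_cat tt'.
have om g y : g (o k) = w ++ y -> g (o m) = w.
  have -> : o k = o m ++ o (size t).
    by rewrite -oD /k size_cat sw.
  rewrite tsectionP => /(congr1 (take m)).
  by rewrite !take_size_cat // size_taut size_nseq.
have [|h1 [h2 [H1 H2 d1 d2 [l Ll El]]]] := mP (c g1^-1, c g2^-1) _ k.
  exists g1, g2; split=> //; exists 1; first exact: sub1.
  by rewrite taut1 (om _ _ E1) (om _ _ E2).
exists (g2 * h2^-1 * l * (h1 * g1^-1)).
  by apply: subM => //; [apply: subM => //|]; apply: cL.
by rewrite -E1 -E2 !tautM tautK El tautK.
Qed.

(** The closure of [L] contains a level stabiliser of [G]. If a colour has an element fixing level
    [m], it has one fixing any given level [k]; dividing [g] by the one of its own colour lands in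
    [L] without changing the action on level [k]. *)
Lemma fi_dense L : is_subgroup L -> fi L G ->
  exists m, forall g k, G g -> fixlev m g -> exists2 l, L l & agree k l g.
Proof.
move=> sL [LG [C [c cP]]]; have [x0 _] := two_letters.
pose P a k := exists g, [/\ G g, c g = a & fixlev k g].
have [m mP] : exists m, forall a, P a m -> forall k, P a k.
  apply: antitone_stable => a k [g [Gg cg fg]]; exists g; split=> //.
  exact: agree_le fg _.
exists m => g k Gg mg.
have [|h [Gh ch hk]] := mP (c g) _ k; first by exists g.
exists (h^-1 * g); first exact: cP.
by move=> w sw; rewrite tautM; apply: tautV_fix; rewrite hk // size_taut.
Qed.

(** [g] is the product of its restrictions. The induction follows partial products, which act as [g]
    below the vertices already treated and trivially elsewhere. *)
Lemma glue N n g (x0 : X) : is_subgroup N -> fixlev n g ->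
  (forall y, size y = n -> N (restr y g)) -> N g.
Proof.
move=> sN ng Ny.
have rec (s : seq (seq X)) : {subset s <= words X n} -> uniq s ->
    exists2 h, N h & forall w, h w = if has (fun y => prefix y w) s then g w else w.
  elim: s => [|y s IH] sub; first by exists 1; [apply: sub1|].
  case/andP=> ys us; have [|h Nh hP] := IH _ us.
    by move=> z zs; apply: sub; rewrite inE zs orbT.
  have sy : size y = n by apply/eqP; rewrite -mem_words sub ?mem_head.
  exists (restr y g * h) => [|w]; first by apply: subM => //; apply: Ny.
  have -> : has (fun z => prefix z w) (y :: s) = prefix y w || has (fun z => prefix z w) s by [].
  rewrite tautM hP; case: (boolP (prefix y w)) => yw; rewrite ?orTb ?orFb.
    have -> : has (fun y => prefix y w) s = false.
      apply/hasPn => z zs; apply/negP => zw.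
      have sz : size z = n by apply/eqP; rewrite -mem_words sub // inE zs orbT.
      by case/negP: ys; rewrite (prefix_eqsize yw zw) ?sy.
    by rewrite -(prefix_drop yw) restr_cat // ng.
  have gy : g y = y by exact: ng.
  by rewrite restr_Sup //; case: ifP => // _; rewrite -gy taut_prefix.
have [//||h Nh hP] := rec (words X n); first exact: words_uniq.
suff -> : g = h by [].
apply/taut_eq => w; rewrite hP; case: (boolP (has _ _)) => // /hasPn no.
have sw : size w < n.
  rewrite ltnNge; apply/negP => nw; have := no (take n w).
  by rewrite mem_words size_takel // eqxx prefix_take_le => /(_ isT).
by apply: (agree_le x0 ng (ltnW sw)).
Qed.

Lemma Ristv_subgroup w : is_subgroup (Ristv G w).
Proof. exact: (subgroupI sG (Sup_subgroup w)). Qed.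

Lemma Rist_level_restr n g : Rist_level G n g ->
  [/\ G g, fixlev n g & forall y, size y = n -> Ristv G y (restr y g)].
Proof.
pose M := [set g | [/\ G g, fixlev n g & forall y, size y = n -> G (restr y g)]].
have mor y : size y = n -> morph_on (restr y) (fixlev n).
  by move=> sy; apply: restr_morph => h hn; apply: hn.
have sM : is_subgroup M.
  apply: is_subgroupP.
  - split; [exact: sub1|exact: (sub1 (fixlev_subgroup n))|] => y sy.
    by rewrite (morph1 (fixlev_subgroup n) (mor y sy)); apply: sub1.
  - move=> x [Gx xn xy]; split; [exact: subV|exact: (subV (fixlev_subgroup n))|] => y sy.
    by rewrite (morphV (fixlev_subgroup n) (mor y sy)) //; apply: subV => //; apply: xy.
  - move=> x z [Gx xn xy] [Gz zn zy]; split; [exact: subM|exact: (subM (fixlev_subgroup n))|] =>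
    y sy.
    by rewrite (mor y sy) //; apply: subM; [|apply: xy|apply: zy].
suff: Rist_level G n `<=` M.
  by move=> + /[dup] => /[apply] -[Gg gn gy] _; split=> // y sy; split;
    [apply: gy|apply: restr_Sup].
apply: generated_min => // h [v vn [Gh hv]]; split=> //.
  move=> w sw; case: (pselect (w = v)) => [->|wv]; first exact: Sup_self.
  apply: hv; apply/negP => p; apply/wv/esym/prefix_size_eq => //; by rewrite sw vn.
move=> y sy; case: (pselect (y = v)) => [->|yv]; first by rewrite /restr graft_tsection.
have /FixE[_ h1] : Fix y h.
  by apply: Sup_Fix_incomparable hv; apply: eqsize_incomparable; rewrite ?sy ?vn // => /esym.
rewrite /restr h1 (_ : graft y 1 = 1); first exact: sub1.
apply/taut_eq => w; case: (boolP (prefix y w)) => p; last by rewrite graft_Sup.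
by rewrite -(prefix_drop p) graft_cat.
Qed.

Lemma restr_Rist_level n y : size y = n -> restr y @` Rist_level G n = Ristv G y.
Proof.
move=> sy; apply/seteqP; split=> [_ [g /Rist_level_restr[_ _ gy] <-]|g gy]; first exact: gy.
exists g; last by rewrite /restr graft_tsection //; case: gy.
by apply: generated_sub; exists y.
Qed.

(** [Rist_level G n] is the product of the groups [Ristv G y], so finite index in every factor gives
    finite index in it, hence in [G]. *)
Lemma fi_Ristv n N : is_subgroup N ->
  (forall y, size y = n -> fi (N `&` Ristv G y) (Ristv G y)) -> fi (N `&` G) G.
Proof.
move=> sN Ny; have [x0 _] := two_letters.
have sR : is_subgroup (Rist_level G n) by apply: generated_subgroup.
apply: fi_between (fi_trans sR _ (ristG n)); [|by move=> x []|]; last first.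
  apply: (@fi_bigI _ _ (words X n) (fun y => [set g | Rist_level G n g /\ (N `&` Ristv G y)
    (restr y g)])) => //.
  move=> y; rewrite mem_words => /eqP sy; apply: fi_preimage (Ny y sy) => //.
    by apply: restr_morph => g /Rist_level_restr[_ gn _]; apply: gn.
  by rewrite (restr_Rist_level sy).
move=> g [Rg gP]; have [Gg gn _] := Rist_level_restr Rg; split=> //.
apply: (glue x0 sN gn) => y sy.
by have [|_ []] := gP y; rewrite ?mem_words ?sy.
Qed.

(** Otherwise [Ristv G w] would be finite, by conjugation so would every rigid stabiliser of that
    level, and then [G] itself; the trivial group would be transitive below deep vertices. *)
Lemma fi_Sup L w : is_subgroup L -> fi L G -> exists r, [/\ L r, Sup w r & r <> 1].
Proof.
move=> sL fL; apply: contrapT => /forallNP no.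
have L1 r : L r -> Sup w r -> r = 1.
  by move=> Lr wr; apply: contrapT => r1; apply: (no r).
have f1 : fi [set 1] (Ristv G w).
  apply: fi_between (fi_setIl (Ristv_subgroup w) _ fL); last by move=> x [].
    by move=> x [Lx [_ xw]] /=; apply: L1.
  by move=> _ ->; apply: sub1; apply: Ristv_subgroup.
have : fi ([set 1] `&` G) G.
  apply: (fi_Ristv (n := size w)) => [|y sy]; first exact: subgroup1.
  have [g Gg gy] : exists2 g : taut X, G g & g w = y by apply: (@trG (size w)).
  have cm : morph_on (fun r => g * r * g^-1) (Ristv G w).
    by move=> a b _ _; rewrite !mulgA mulgVK.
  have := fi_image (Ristv_subgroup w) cm f1.
  have <- : (fun r => g * r * g^-1) @` Ristv G w = Ristv G y.
    apply/seteqP; split=> [_ [r [Gr rw] <-]|r [Gr ry]].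
      split; last by rewrite -gy; apply: Sup_conj.
      by apply: subM; [|apply: subM|apply: subV].
    exists (g^-1 * r * g); last by rewrite !mulgA mulgV mul1g mulgK.
    split; first by apply: subM => //; apply: subM => //; apply: subV.
    by have := Sup_conj (g := g^-1) ry; rewrite invgK -gy tautK.
  apply: fi_between; last by move=> x [].
  move=> _ [_ -> <-]; rewrite mulg1 mulgV; split=> //.
  by exists 1; [exact: (sub1 (Ristv_subgroup w))|rewrite mulg1 mulgV].
move=> f; have [x0 [x1 x01]] := two_letters.
have [|m mP] := fi_below_trans _ f; first by apply: subgroupI => //; exact: subgroup1.
have [|l [-> _]] := mP (nseq m x0) _ [:: x0] [:: x1] erefl; first by rewrite size_nseq.
by rewrite taut1 => /catI[].
Qed.

(** If [a] moves [w ++ z], it conjugates any non-trivial [b] supported below [w ++ z] to an element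
    with disjoint support. *)
Lemma fi_nonabelian L w : is_subgroup L -> fi L G ->
  exists a b, [/\ L a, L b, Sup w a, Sup w b & a * b <> b * a].
Proof.
move=> sL fL; have [a [La wa a1]] := fi_Sup w sL fL; have [z az] := Sup_moves wa a1.
have [b [Lb bw b1]] := fi_Sup (w ++ z) sL fL.
exists a, b; split=> //; first by apply: Sup_prefix bw; apply: prefix_prefix.
move=> E; apply: b1; apply: (Sup_Fix1 bw).
apply: Sup_Fix_incomparable (moved_incomparable az) _.
have -> : b = a * b * a^-1 by rewrite E mulgK.
exact: Sup_conj.
Qed.

Section Torsion.
Hypotheses (fgG : fg G) (torG : forall g, G g -> exists2 n, (0 < n)%N & g ^+ n = 1).

(** By transitivity of [L] on deep subtrees, [N] moves every vertex of some level [m + k]. There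
    [comm_incomparable] puts into [N] the commutators of the part of [L] in each rigid stabiliser,
    and [fi_comm] applies. *)
Lemma fi_normal L N : is_subgroup L -> fi L G -> is_subgroup N -> normalises L N ->
  (forall y, exists2 n, N n & exists z, n (y ++ z) <> y ++ z) -> fi (N `&` G) G.
Proof.
move=> sL fL sN nN mv; have [x0 _] := two_letters.
have [m mP] := fi_below_trans sL fL.
have [k kP] : exists k, forall w, w \in words X m -> forall j, k <= j ->
    exists2 n, N n & exists2 z, size z = j & n (w ++ z) <> w ++ z.
  apply: choose_bound => w _; have [n Nn [z nz]] := mv w.
  exists (size z) => j zj; exists n => //; exists (z ++ nseq (j - size z) x0).
    by rewrite size_cat size_nseq subnKC.
  by rewrite catA => /taut_fix_prefix.
have movedy y : size y = m + k -> exists2 n, N n & n y <> y.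
  move=> sy; have sw : size (take m y) = m by rewrite size_takel // sy leq_addr.
  have [|n Nn [z sz nz]] := kP (take m y) _ k (leqnn k); first by rewrite mem_words sw.
  have [||l Ll lz] := mP (take m y) _ z (drop m y); rewrite ?sw //.
    by rewrite size_drop sy sz addKn.
  rewrite cat_take_drop in lz; exists (l * n * l^-1); first exact: nN.
  by rewrite -lz !tautM tautK => /taut_inj.
apply: (fi_Ristv (n := m + k)) => // y sy; have [j Nj jy] := movedy y sy.
have sR := subgroupI sL (Ristv_subgroup y).
have fR : fi (L `&` Ristv G y) (Ristv G y) by apply: fi_setIl fL => //;
  [apply: Ristv_subgroup|move=> x []].
(* [Ristv G y] is the image under restriction of [Rist_level], which is finitely generated by
   Schreier's lemma. *)
have fgR : fg (L `&` Ristv G y).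
  apply: fg_fi fR _ => //; rewrite -(restr_Rist_level sy); apply: fg_image.
  - exact: generated_subgroup.
  - by apply: restr_morph => g /Rist_level_restr[_ gn _]; apply: gn.
  - by apply: fg_fi (ristG _) fgG; apply: generated_subgroup.
apply: fi_between (fi_trans sR _ fR); [|by move=> x []|]; last first.
  apply: (@fi_comm _ (L `&` Ristv G y) (N `&` (L `&` Ristv G y))) => //.
  - exact: subgroupI.
  - move=> a b [La [Ga Sa]] [Lb [Gb Sb]].
    have Rc : (L `&` Ristv G y) (comm a b).
      by rewrite /comm; do !apply: (subM sR); rewrite ?invgK; try apply: (subV sR).
    split=> //; exact: (@comm_incomparable N L y j).
  - by move=> x [Lx [Gx _]]; apply: torG.
by move=> x [Nx [_ Rx]]; split.
Qed.

End Torsion.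
End Group.
End Tree.

(** * Links between vertices *)

Section Links.
Variable X : finType.
Implicit Types (u v w z y t p q : seq X) (g h j : taut X) (H K L N : set (taut X)).

Lemma Stv_subgroup H u : is_subgroup H -> is_subgroup (Stv H u).
Proof. by move=> sH; apply: (subgroupI sH (stab_subgroup u)). Qed.

Lemma fi_Stv H u : is_subgroup H -> fi (Stv H u) H.
Proof.
move=> sH; split; first by move=> h [].
exists 'I_(size (words X (size u))).+1, (fun h => inord (index (h u) (words X (size u)))).
move=> g h Hg Hh /(congr1 val) /=; rewrite !inordK ?ltnS ?index_size // => E.
split; first by apply: subM => //; apply: subV.
have {}E : g u = h u.
  have mw (f : taut X) : f u \in words X (size u) by rewrite mem_words size_taut.
  by rewrite -(nth_index [::] (mw g)) E nth_index.
by rewrite tautM -E tautK.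
Qed.

Definition J H w := H `&` Fix w.
Definition link H a b := J H a `<=` J H b.

Lemma J_subgroup H w : is_subgroup H -> is_subgroup (J H w).
Proof. by move=> sH; apply: subgroupI (Fix_subgroup w). Qed.

Lemma link_trans H a b c : link H a b -> link H b c -> link H a c.
Proof. exact: subset_trans. Qed.
Lemma link_cat H a b : link H a (a ++ b).
Proof. by move=> h [Hh ha]; split=> //; apply: Fix_prefix ha; apply: prefix_prefix. Qed.
Lemma link_act H h a b : is_subgroup H -> H h -> link H a b -> link H (h a) (h b).
Proof.
move=> sH Hh ab j [Hj ja]; split=> //.
have [_ jb] : J H b (h^-1 * j * h).
  apply: ab; split; first by do ?apply: subM => //; apply: subV.
  by have := Fix_conj h^-1 ja; rewrite tautK invgK.
by have := Fix_conj h jb; rewrite !mulgA mulgV mul1g mulgK.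
Qed.

Lemma Fix_deep (x0 : X) w g k : (forall t, size t = k -> Fix (w ++ t) g) -> Fix w g.
Proof.
move=> F z; pose e := z ++ nseq k x0.
have : g (w ++ e) = w ++ e.
  have st : size (take k e) = k by rewrite size_takel // size_cat size_nseq leq_addl.
  by rewrite -(cat_take_drop k e) catA F.
by rewrite /e catA => /taut_fix_prefix.
Qed.

Section Group.
Variable G : set (taut X).
Hypotheses (sG : is_subgroup G) (ntG : G <> [set 1]) (trG : level_transitive G).
Hypothesis ristG : forall n : nat, fi (Rist_level G n) G.
Hypotheses (fgG : fg G) (torG : forall g, G g -> exists2 n : nat, (0 < n)%N & g ^+ n = 1).
Hypothesis srG : forall v, tsection v @` Stv G v = G.

(** By self-replication [G] is also the group of sections at [v] of its stabiliser, so this is the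
    finite index condition of a diagonal block. *)
Definition full H v := (forall h, H h -> h v = v) /\ fi (tsection v @` H) G.

Lemma full_morph H v : full H v -> morph_on (tsection v) H.
Proof. by case=> Hv _; apply: tsection_morph. Qed.

Lemma full_image H v : is_subgroup H -> full H v -> is_subgroup (tsection v @` H).
Proof. by move=> sH fH; apply: image_subgroup sH (full_morph fH). Qed.

Lemma full_fi H K v : is_subgroup H -> fi K H -> full H v -> full K v.
Proof.
move=> sH fK fH; split; first by move=> h /fK.1; apply: fH.1.
apply: fi_trans fH.2; first exact: full_image.
exact: fi_image (full_morph fH) fK.
Qed.

(** Intersecting with a stabiliser keeps finite index, and the sections at [w] of the stabiliser of
    [w] in [G] fill [G] by self-replication. *)
Lemma full_Stv H v w : is_subgroup H -> full H v -> full (Stv H (v ++ w)) (v ++ w).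
Proof.
move=> sH fH; split; first by move=> h [].
have sL := full_image sH fH.
have sS := Stv_subgroup w sG.
have mS : morph_on (tsection w) (Stv G w) by apply: tsection_morph => g [].
have SG : Stv G w `<=` G by move=> g [].
have := fi_image sS mS (fi_setIl sS SG fH.2); rewrite (srG w).
apply: fi_between.
  move=> _ [_ [[h Hh <-] [_ hw]] <-]; exists h; last by rewrite tsection_cat.
  by split=> //; rewrite tsection_eq ?hw //; apply: fH.1.
move=> _ [h [Hh hvw] <-]; rewrite tsection_cat -(srG w).
have hv : h v = v by apply: fH.1.
exists (tsection v h) => //; split; first by apply: fH.2.1; exists h.
by apply: (@catI _ v); rewrite -tsection_eq.
Qed.

Lemma full_desc H K v w : is_subgroup H -> full H v -> is_subgroup K ->
  fi K (Stv H (v ++ w)) -> full K (v ++ w).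
Proof.
move=> sH fH sK fK; apply: full_fi fK _; first exact: Stv_subgroup.
exact: full_Stv.
Qed.

(** The support of [a] is controlled in the tree at [v] alone; how [a] acts on other trees is left
    open, which is what allows links between trees. *)
Lemma full_Sup H v w : is_subgroup H -> full H v ->
  exists2 a, H a & (forall z, ~~ prefix w z -> a (v ++ z) = v ++ z) /\
    exists z, a (v ++ w ++ z) <> v ++ w ++ z.
Proof.
move=> sH fH; have [_ [[a Ha <-] aw a1]] := fi_Sup sG ntG trG ristG w (full_image sH fH) fH.2.
have av : a v = v by apply: fH.1.
exists a => //; split=> [z /aw az|]; first by rewrite tsection_eq // az.
have [z az] := Sup_moves aw a1; exists z; rewrite tsection_eq // => /catI; exact: az.
Qed.

(** Otherwise some [c] below [b] is incomparable to [a], and an element of [H] acting in this tree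
    only below [c] fixes the tree at [v ++ a] but not the one at [v ++ b]. *)
Lemma link_inv H v a b : is_subgroup H -> full H v -> link H (v ++ a) (v ++ b) -> prefix a b.
Proof.
move=> sH fH ab; case: (boolP (prefix a b)) => // nab; exfalso.
have [c bc ac] : exists2 c, prefix b c & ~~ comparable a c.
  case: (boolP (prefix b a)) => [/prefixP[[|x s] E]|nba].
  - by move: nab; rewrite E cats0 prefix_refl.
  - have [x0 [x1 x01]] := two_letters sG ntG.
    have [y yx] : exists y : X, y <> x.
      by case: (pselect (x0 = x)) => [<-|]; [exists x1 => /esym|exists x0].
    exists (b ++ [:: y]); first exact: prefix_prefix.
    have /eqP/negPf yx' := yx.
    by rewrite E /comparable !prefix_cat2l /= yx' eq_sym yx'.
  - by exists b; rewrite ?prefix_refl // /comparable negb_or nab.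
have [h Hh [hc [z hz]]] := full_Sup c sH fH.
have [_ hb] : J H (v ++ b) h.
  apply: ab; split=> // t; rewrite -catA hc //; apply/negP => p.
  case/negP: ac; rewrite /comparable; exact: prefix_comparable (prefix_prefix _ _) p.
by apply: hz; case/prefixP: bc => e ->; rewrite -catA catA hb.
Qed.

(** Links can be tested on a finite index subgroup. If [j] in [J H u] moves [p] below [v ++ w], take
    [a] acting in the tree at [v] only below [p]: the commutator of [j] and [a] lies in [H1] and
    fixes the tree at [u], yet acts below [p] as [a^-1]. *)
Lemma link_fi H H1 v u w : is_subgroup H -> full H v -> is_subgroup H1 -> fi H1 H ->
  J H u `&` H1 `<=` Fix (v ++ w) -> link H u (v ++ w).
Proof.
move=> sH fH sH1 fH1 sub j [Hj ju]; split=> //; apply: contrapT => jw.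
have [z jz] : exists z, j (v ++ w ++ z) <> v ++ w ++ z.
  by apply: contrapT => /forallNP F; apply: jw => z; rewrite -catA; apply: contrapT; apply: F.
pose f a := j * a * j^-1.
have mf : morph_on f H by move=> a b _ _; rewrite /f !mulgA mulgVK.
(* The commutator fixes the tree at [u] because [a] fixes the vertex [u], and lies in [H1] because
   [a] and its conjugate by [j] do. *)
pose L1 := (H1 `&` Stv H u) `&` [set a | H a /\ H1 (f a)].
have fL1 : fi L1 H.
  apply: fi_setI; first by apply: fi_setI => //; apply: fi_Stv.
  apply: fi_preimage fH1 => // _ [a Ha <-].
  by do ?apply: subM => //; apply: subV.
have sL1 : is_subgroup L1.
  apply: subgroupI; first by apply: subgroupI => //; apply: Stv_subgroup.
  apply: is_subgroupP.
  - by split; [apply: sub1|rewrite /f mulg1 mulgV; apply: sub1].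
  - by move=> a [Ha fa]; split; [apply: subV|rewrite (morphV sH mf)//; apply: subV].
  - by move=> a b [Ha fa] [Hb fb]; split; [apply: subM|rewrite mf //; apply: subM].
have [a [[H1a [Ha au]] [_ H1f]] [aS [t at_]]] := full_Sup (w ++ z) sL1 (full_fi sH fL1 fH).
have vF h : H h -> h v = v by apply: fH.1.
set p := v ++ w ++ z in jz; have Ep s : v ++ (w ++ z) ++ s = p ++ s by rewrite /p -!catA.
rewrite Ep in at_; apply: at_.
have ap : a p = p.
  have sa : Sup (w ++ z) (tsection v a).
    by move=> s /aS; rewrite tsection_eq ?vF // => /catI.
  by rewrite /p tsection_eq ?vF // (Sup_self sa).
have [n [Hn nu] nf] : exists2 n, J H u n & n = f a * a^-1.
  exists (f a * a^-1) => //; split.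
    by rewrite /f; do ?apply: subM => //; do ?apply: subV => //.
  rewrite /f -!mulgA (mulgA a); apply: (subM (Fix_subgroup u)) => //.
  rewrite -{1}au; apply: Fix_conj; exact: (subV (Fix_subgroup u)).
have nw : Fix (v ++ w) n.
  by apply: sub; split; [split|rewrite nf; apply: subM => //; apply: subV].
have E1 : n (a (p ++ t)) = a (p ++ t).
  by rewrite tsection_eq // /p -!catA catA; apply: nw.
rewrite -[LHS]E1 nf /f !tautM tautK.
have [s Es sp] : exists2 s, j^-1 (p ++ t) = v ++ s & ~~ prefix (w ++ z) s.
  have Hjv := subV sH Hj.
  exists (tsection v j^-1 ((w ++ z) ++ t)).
    by rewrite -Ep tsection_eq ?vF //.
  apply/negP => pp; apply: jz; rewrite -{1}(_ : j^-1 p = p) ?tautVK //.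
  apply: (@prefix_eqsize _ _ _ (j^-1 (p ++ t))); rewrite ?size_taut //.
    by rewrite taut_prefix prefix_prefix.
  by rewrite -Ep tsection_eq ?vF // /p prefix_cat2l.
by rewrite Es aS // -Es tautVK.
Qed.

Lemma trans_below K v : is_subgroup K -> full K v -> exists m, forall w, m <= size w ->
  forall t t', size t = size t' -> exists2 h, K h & h (v ++ w ++ t) = v ++ w ++ t'.
Proof.
move=> sK fK; have [m mP] := fi_below_trans sG ntG trG (full_image sK fK) fK.2.
exists m => w mw t t' /(mP w mw)[_ [h Kh <-] ht]; exists h => //.
by rewrite tsection_eq ?ht //; apply: fK.1.
Qed.

(** The stabiliser of [u] permutes the links from [u], so one link below [w] gives links to all
    words of that length below [w]. *)
Lemma link_up H K u w z : is_subgroup H -> K `<=` Stv H u ->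
  (forall t t', size t = size t' -> exists2 h, K h & h (w ++ t) = w ++ t') ->
  link H u (w ++ z) -> link H u w.
Proof.
move=> sH KH Kw uz h uh; split; first exact: uh.1.
have [x0 _] := two_letters sG ntG.
apply: (Fix_deep (k := size z) x0) => t st.
have [g /KH[Hg gu] gz] := Kw z t (esym st).
by have := link_act sH Hg uz; rewrite gu gz => /(_ _ uh) [].
Qed.

(* If [w] did not link back into the tree below [u], the section at [u] of
   [J H w] would be normal and non-trivial everywhere, hence of finite index;
   as [J H u] lies in [J H w], so would [J H w] be. *)
Lemma link_back H v p v' p' : is_subgroup H -> full H v -> full H v' ->
  link H (v ++ p) (v' ++ p') -> exists y, link H (v' ++ p') (v ++ p ++ y).
Proof.
set u := v ++ p; set w := v' ++ p'; move=> sH fH fH' uw; apply: contrapT => /forallNP no.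
pose H0 := Stv H w `&` Stv H u.
have sH0 : is_subgroup H0 by apply: subgroupI; apply: Stv_subgroup.
have fH0 : fi H0 H by apply: fi_setI; apply: fi_Stv.
have fuH0 : full H0 u.
  apply: full_desc fH sH0 _ => //; apply: fi_setIl (Stv_subgroup u sH) _ (fi_Stv w sH) => x [] //.
have mH0 := full_morph fuH0.
have sN0 : is_subgroup (J H w `&` H0) by apply: subgroupI => //; apply: J_subgroup.
have N0H0 : J H w `&` H0 `<=` H0 by move=> x [].
have fN : fi ((tsection u @` (J H w `&` H0)) `&` G) G.
  apply: (fi_normal sG ntG trG ristG fgG torG (full_image sH0 fuH0) fuH0.2).
  - by apply: image_subgroup => // x y /N0H0 ? /N0H0; apply: mH0.
  - move=> _ _ [x Hx <-] [n Nn <-]; have Hn := N0H0 _ Nn; exists (x * n * x^-1).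
      split; last by do ?apply: (subM sH0) => //; apply: (subV sH0).
      have [[Hx1 xw] _] := Hx; have [[Hn1 nw] _] := Nn; split.
        by do ?apply: (subM sH) => //; apply: (subV sH).
      by rewrite -{1}xw; apply: Fix_conj.
    by rewrite !mH0 ?(morphV sH0 mH0) //; do ?apply: (subM sH0) => //; apply: (subV sH0).
  - move=> y; apply: contrapT => noy; apply: (no y).
    apply: (link_fi sH fH sH0 fH0) => n [Jn H0n] z.
    apply: contrapT => nz; apply: noy; exists (tsection u n); first by exists n.
    exists z => nz'; apply: nz; rewrite catA -/u -catA tsection_eq ?nz' //.
    by case: H0n => [_ []].
pose M := [set h | H0 h /\ (tsection u @` (J H w `&` H0) `&` G) (tsection u h)].
have fM : fi M H0 by apply: (fi_preimage sH0 mH0 _ fN); apply: fuH0.2.1.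
have fJ : fi (J H w `&` H0) H.
  apply: fi_trans fH0 => //; apply: fi_between fM => // h [H0h [[n [Jn H0n] E] _]]; split=> //.
  split; first by case: H0h => [[]].
  have Hn : H n by case: Jn.
  have Hh : H h by case: H0h => [[]].
  (* Having the same section at [u], the elements [h] and [n] differ by an element of [J H u], hence
     of [J H w]. *)
  have [_ nh] : J H w (n^-1 * h).
    apply: uw; split; first by apply: subM => //; apply: subV.
    have nu : n u = u by case: H0n => [_ []].
    have hu : h u = u by case: H0h => [_ []].
    apply/FixE; split; first by rewrite tautM hu tautV_fix.
    by rewrite mH0 ?(morphV sH0 mH0) ?E ?mulVg //; apply: subV.
  by rewrite -[h](mulVKg n); apply: (subM (Fix_subgroup w)) nh; case: Jn.
(* A finite index subgroup of [H] acts non-trivially below [w], whereas [J H w] does not. *)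
have [a [[_ aw] _] [_ [z az]]] := full_Sup p' sN0 (full_fi sH fJ fH').
by apply: az; rewrite catA aw.
Qed.

(** The common target links back below [v' ++ a], so [link_inv] makes [b] a prefix of an extension
    of [a]. *)
Lemma link_comparable H v p v' a b : is_subgroup H -> full H v -> full H v' ->
  link H (v' ++ a) (v ++ p) -> link H (v' ++ b) (v ++ p) -> prefix a b || prefix b a.
Proof.
move=> sH fH fH' La Lb; have [y Ly] := link_back sH fH' fH La.
have := link_inv sH fH' (link_trans Lb Ly) => pb.
by apply: prefix_comparable pb; apply: prefix_prefix.
Qed.

Definition moves_below v y N := forall y', prefix y y' ->
  exists2 n, N n & exists z, n (v ++ y' ++ z) <> v ++ y' ++ z.

(** Let [j] in [N1] move [z], and let [n] in [N2] act in the tree at [v] only below [z]. Their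
    commutator lies in both groups and acts below [z] as [n^-1]. *)
Lemma moves_belowI H v y N1 N2 : is_subgroup H -> full H v ->
  is_subgroup N1 -> is_subgroup N2 -> N1 `<=` H -> N2 `<=` H ->
  normalises H N1 -> normalises H N2 ->
  moves_below v y N1 -> moves_below v y N2 -> moves_below v y (N1 `&` N2).
Proof.
move=> sH fH sN1 sN2 N1H N2H nN1 nN2 m1 m2 y' yy'.
have mH := full_morph fH.
have vF h : H h -> h v = v by apply: fH.1.
have [j N1j [z0 jz]] := m1 y' yy'; have Hj := N1H j N1j.
set z := y' ++ z0 in jz.
have [|n0 N2n0 [z1 nz1]] := m2 z.
  by apply: prefix_trans yy' _; apply: prefix_prefix.
have Hn0 := N2H _ N2n0.
have [_ [_ [[a Ha <-] [b Hb <-] aS bS ab]]] :=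
  fi_nonabelian sG ntG trG ristG (z ++ z1) (full_image sH fH) fH.2.
(* [a] and [b] may act outside the tree at [v], so the commutator trick is applied to sections, and
   [n] is a lift to [N2]. *)
have [n N2n En] : (tsection v @` N2) (comm (tsection v a) (tsection v b)).
  apply: (@comm_incomparable _ _ (tsection v @` H) (z ++ z1) (tsection v n0)) => //.
  - by apply: image_subgroup => // g h /N2H ? /N2H; apply: mH.
  - exact: full_image.
  - move=> _ _ [x Hx <-] [m Nm <-]; have Hm := N2H _ Nm; exists (x * m * x^-1); first exact: nN2.
    by rewrite !mH ?(morphV sH mH) //; do ?apply: (subM sH) => //; apply: (subV sH).

  - by move=> E; apply: nz1; rewrite tsection_eq ?E // vF.

have Hn := N2H n N2n.
set s := tsection v n in En.
have sz1 : Sup (z ++ z1) s.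
  have S := Sup_subgroup (z ++ z1); rewrite En /comm.
  by do ?apply: (subM S) => //; apply: (subV S).
have sz : Sup z s by apply: Sup_prefix sz1; apply: prefix_prefix.
have s1 : s <> 1.
  by rewrite En => /comm_eq1.
have [t st] := Sup_moves sz s1.
exists (comm j n).
  split; rewrite /comm.
    by rewrite -!mulgA (mulgA n); apply: subM => //; apply: nN1 => //; apply: subV.
  by apply: subM; [|apply: nN2|apply: subV].
have Ec : tsection v (comm j n) = comm (tsection v j) s.
  by rewrite /comm !mH ?(morphV sH mH) //; do ?apply: subM => //; apply: subV.
have cv : comm j n v = v by apply: vF; rewrite /comm; do ?apply: subM => //; apply: subV.
have Es : s (z ++ t) = z ++ tsection z s t by rewrite tsection_eq // (Sup_self sz).
have nfix : Fix z (tsection v j * s * (tsection v j)^-1).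
  apply: Sup_Fix_incomparable (Sup_conj sz); apply: moved_incomparable => E.
  by apply: jz; rewrite tsection_eq ?E // vF.
exists (z0 ++ tsection z s t); rewrite (catA y') -/z tsection_eq // Ec => /catI.
rewrite /comm tautM -Es tautK nfix Es => E; apply: st; rewrite Es; exact: esym E.
Qed.

Lemma moves_below_bigI (I : eqType) (e : seq I) H v y (N : I -> set (taut X)) :
  is_subgroup H -> full H v -> (forall i, i \in e ->
    [/\ is_subgroup (N i), normalises H (N i) & moves_below v y (H `&` N i)]) ->
  moves_below v y [set h | H h /\ forall i, i \in e -> N i h].
Proof.
move=> sH fH NP.
suff [_ _ []] : let M := [set h | H h /\ forall i, i \in e -> N i h] in
  [/\ is_subgroup M, normalises H M & moves_below v y M /\ True] by [].
elim: e NP => [|i e IH] NP /=.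
  split.
  - by apply: is_subgroupP => [|x [Hx _]|x z [Hx _] [Hz _]]; split=> //;
    [apply: sub1|apply: subV|apply: subM].
  - by move=> x n Hx [Hn _]; split=> //; do ?apply: (subM sH) => //; apply: (subV sH).
  - split=> // y' _; have [a Ha [_ az]] := full_Sup y' sH fH; by exists a.
have [|sM nM [mM _]] := IH; first by move=> j je; apply: NP; rewrite inE je orbT.
have [sN nN mN] := NP i (mem_head i e).
set M := [set h | H h /\ forall i, i \in e -> N i h] in sM nM mM.
have -> : [set h | H h /\ (forall k, k \in i :: e -> N k h)] = (H `&` N i) `&` M.
  apply/seteqP; split=> [h [Hh hN]|h [[Hh Nh] [_ hN]]].
    split; split=> //; first by apply: hN; rewrite mem_head.
    by move=> j je; apply: hN; rewrite inE je orbT.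
  by split=> // j; rewrite inE => /orP[/eqP->//|]; apply: hN.
have sHN := subgroupI sH sN.
have nHN : normalises H (H `&` N i).
  move=> x n Hx [Hn Nn]; split; last exact: nN.
  by do ?apply: (subM sH) => //; apply: (subV sH).
split; first exact: subgroupI.
- by move=> x n Hx [HNn Mn]; split; [apply: nHN|apply: nM].
- by split=> //; apply: (moves_belowI sH fH) => // h [].
Qed.

(* The fixators of the trees below the [z] of a given length are normal and
   their intersection acts trivially below [b]; so they cannot all act
   non-trivially everywhere below a point of the tree of [b]. *)
Lemma link_split H v' q' v q k' : is_subgroup H -> full H v ->
  link H (v' ++ q') (v ++ q) ->
  exists k, forall y, k <= size y ->
    exists2 z, size z = k' & link H (v' ++ q' ++ z) (v ++ q ++ y).
Proof.
set a := v' ++ q'; set b := v ++ q => sH fH ab.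
have [x0 _] := two_letters sG ntG.
(* Fixing each [a ++ z] makes their fixators normalised by [H0]; fixing [b] keeps sections there. *)
pose H0 := [set h | H h /\ forall z, z \in words X k' -> Stv H (a ++ z) h] `&` Stv H b.
have sH0 : is_subgroup H0.
  apply: subgroupI; last exact: Stv_subgroup.
  apply: is_subgroupP => [|x [Hx xS]|x y [Hx xS] [Hy yS]]; split.
  - exact: sub1.
  - by move=> z _; apply: (sub1 (Stv_subgroup _ sH)).
  - exact: subV.
  - by move=> z zw; apply: (subV (Stv_subgroup _ sH)); apply: xS.
  - exact: subM.
  - by move=> z zw; apply: (subM (Stv_subgroup _ sH)); [apply: xS|apply: yS].
have fH0 : fi H0 H.
  by apply: fi_setI (fi_Stv b sH); apply: fi_bigI => // z _; apply: fi_Stv.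
have fbH0 : full H0 b.
  apply: full_desc fH sH0 _ => //; apply: (fi_setIl (H := H) (Stv_subgroup b sH));
    first by move=> x [].
  by apply: fi_bigI => // z _; apply: fi_Stv.
have [k kP] := trans_below sH0 fbH0.
exists k => y ky; apply: contrapT => no.
have noz z y' : size z = k' -> prefix y y' -> ~ link H (a ++ z) (b ++ y').
  move=> sz /prefixP[t ->]; rewrite catA => /(link_up (K := H0) sH) L.
  apply: no; exists z => //; rewrite !catA; apply: L.
    move=> h [[Hh /(_ z)]]; rewrite mem_words sz eqxx => /(_ isT) //.
  by move=> t1 t2 /(kP y ky)[h H0h ht]; exists h => //; rewrite -!(catA b).
have m : moves_below b y [set h | H0 h /\ forall z, z \in words X k' -> Fix (a ++ z) h].
  apply: moves_below_bigI => // z; rewrite mem_words => /eqP sz; split.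
  - exact: Fix_subgroup.
  - move=> x n [[Hx /(_ z)]]; rewrite mem_words sz eqxx => /(_ isT)[_ xz] _ nz.
    by rewrite -{1}xz; apply: Fix_conj.
  - move=> y' yy'; apply: contrapT => nm; apply: (noz z y' sz yy').
    rewrite /b -(catA v q y'); apply: (link_fi sH fH sH0 fH0) => n [[Hn nz] H0n] t.
    apply: contrapT => nt; apply: nm; exists n; first by split.
    by exists t; rewrite catA -/b -catA in nt *.
(* An element fixing every tree at [a ++ z] fixes the tree at [a], so by [ab] it cannot move
   anything below [b]. *)
have [h [H0h hz] [t ht]] := m y (prefix_refl y).
have [_ hb] : J H b h.
  apply: ab; split; first by case: H0h => [[]].
  apply: (Fix_deep (k := k') x0) => z sz; apply: hz; by rewrite mem_words sz.
by apply: ht; rewrite hb.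
Qed.

End Group.
End Links.

(** * Elements of small support *)

Lemma count_sub_in (T : eqType) (P Q : pred T) (s : seq T) :
  (forall x, x \in s -> P x -> Q x) -> count P s <= count Q s.
Proof.
elim: s => //= x s IH PQ; apply: leq_add; last first.
  by apply: IH => y ys; apply: PQ; rewrite inE ys orbT.
by case Px: (P x); rewrite // PQ ?mem_head.
Qed.

Section Fibres.
Local Open Scope nat_scope.
Variables (A B : eqType) (Q : pred A) (P : pred B) (R : A -> B -> bool) (c : nat).
Variables (s : seq A) (T : seq B).

Lemma count_fibres_ge : uniq s ->
  (forall z, z \in s -> Q z -> c <= count (fun t => P t && R z t) T) ->
  (forall t z z', z \in s -> z' \in s -> Q z -> Q z' -> R z t -> R z' t -> z = z') ->
  c * count Q s <= count P T.
Proof.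
suff main : uniq s ->
  (forall z, z \in s -> Q z -> c <= count (fun t => P t && R z t) T) ->
  (forall t z z', z \in s -> z' \in s -> Q z -> Q z' -> R z t -> R z' t -> z = z') ->
  c * count Q s <= count (fun t => P t && has (fun z => Q z && R z t) s) T.
  move=> us cs Rs; apply: leq_trans (main us cs Rs) _.
  by apply: sub_count => t /andP[].
elim: s => [|x r IH]; first by rewrite muln0.
case/andP=> xr ur cs Rs /=; rewrite mulnDr.
have {}IH := IH ur (fun z zr => cs z (mem_behead (s := x :: r) zr))
  (fun t z z' zr zr' => Rs t z z' (mem_behead (s := x :: r) zr) (mem_behead (s := x :: r) zr')).
case Qx: (Q x) => /=; last first.
  by rewrite muln0 add0n; apply: leq_trans IH _; apply: sub_count.
rewrite muln1.
pose P1 t := P t && R x t; pose P2 t := P t && has (fun z => Q z && R z t) r.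
apply: leq_trans (leq_add (cs x (mem_head x r) Qx) IH) _.
rewrite -[count _ T + _](count_predUI P1 P2).
rewrite (_ : count (predI P1 P2) T = 0).
  rewrite addn0; apply: sub_count => t /orP[] /andP[-> E] //=; first by rewrite E.
  by rewrite E orbT.
apply/eqP; rewrite -leqn0 leqNgt -has_count; apply/hasPn => t _ /=.
apply/negP => /andP[/andP[_ Rx] /andP[_ /hasP[z zr /andP[Qz Rz]]]].
case/negP: xr; rewrite (Rs t x z) ?mem_head //; exact: (mem_behead (s := x :: r)).
Qed.

Lemma count_fibres_le : 
  (forall z, z \in s -> Q z -> count (R z) T <= c) ->
  (forall t, t \in T -> P t -> exists2 z, z \in s & Q z && R z t) ->
  count P T <= c * count Q s.
Proof.
move=> cs PR; apply: (@leq_trans (count (fun t => has (fun z => Q z && R z t) s) T)).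
  apply: count_sub_in => t tT Pt.
  by apply/hasP; have [z zs E] := PR t tT Pt; exists z.
elim: s cs {PR} => [|x r IH] cs /=; first by rewrite muln0 count_pred0.
have {}IH := IH (fun z zr => cs z (mem_behead (s := x :: r) zr)).
rewrite mulnDr; apply: leq_trans (_ : count (fun t => Q x && R x t) T + count (fun t =>
  has (fun z => Q z && R z t) r) T <= _).
  by rewrite -count_predUI leq_addr.
apply: leq_add IH; case Qx: (Q x) => /=; first by rewrite muln1 cs ?mem_head.
by rewrite count_pred0.
Qed.
End Fibres.

Section Small.
Local Open Scope nat_scope.
Variable X : finType.
Implicit Types (u v w z y t p q : seq X) (g h : taut X) (H L N : set (taut X)).
Local Notation d := #|X|.

Definition cnt k (P : pred (seq X)) := count P (words X k).

Lemma cnt_le k (P Q : pred (seq X)) : (forall w, size w = k -> P w -> Q w) -> cnt k P <= cnt k Q.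
Proof. by move=> PQ; apply: count_sub_in => w; rewrite mem_words => /eqP; apply: PQ. Qed.

Lemma cnt_perm k (P : pred (seq X)) g : cnt k (fun w => P (g w)) = cnt k P.
Proof.
rewrite /cnt -(count_map g P); apply/permP/uniq_perm; rewrite ?words_uniq //.
  by rewrite map_inj_uniq ?words_uniq //; apply: taut_inj.
move=> w; rewrite mem_words; apply/mapP/eqP => [[u us ->]|s].
  by apply/eqP; rewrite size_taut -mem_words.
by exists (g^-1 w); rewrite ?tautVK // mem_words size_taut s.
Qed.

Lemma size_words k : size (words X k) = d ^ k.
Proof. by rewrite size_map -cardE card_tuple. Qed.

Lemma cnt_below y k (P : pred (seq X)) :
  cnt (size y + k) (fun u => prefix y u && P (drop (size y) u)) = cnt k P.
Proof.
rewrite /cnt -!size_filter -[RHS](size_map (cat y)); apply: perm_size; apply: uniq_perm.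
- by rewrite filter_uniq // words_uniq.
- by rewrite map_inj_uniq ?filter_uniq ?words_uniq //; apply: catI.
move=> w; rewrite mem_filter mem_words; apply/idP/mapP => [/andP[/andP[p Pw] /eqP s]|[u]].
  exists (drop (size y) w); last by rewrite prefix_drop.
  by rewrite mem_filter Pw mem_words size_drop s addKn eqxx.
rewrite mem_filter mem_words => /andP[Pu /eqP su] ->.
by rewrite prefix_prefix drop_size_cat // Pu size_cat su eqxx.
Qed.

Lemma cnt_prefix y k : cnt (size y + k) (prefix y) = d ^ k.
Proof.
rewrite -size_words -(count_predT (words X k)) -[RHS](cnt_below y).
by apply: eq_count => u /=; rewrite andbT.
Qed.

Lemma cnt_ext j k (P : pred (seq X)) : cnt (j + k) (fun w => P (take j w)) = d ^ k * cnt j P.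
Proof.
have tk t : t \in words X (j + k) -> size (take j t) = j.
  by rewrite mem_words => /eqP s; rewrite size_takel // s leq_addr.
have pre z t : size z = j -> prefix z t -> take j t = z.
  by move=> sz /prefixP[e ->]; rewrite take_size_cat.
have cz z : z \in words X j -> count (fun t => prefix z t) (words X (j + k)) = d ^ k.
  by rewrite mem_words => /eqP <-; apply: cnt_prefix.
apply/eqP; rewrite eqn_leq; apply/andP; split.
  apply: (@count_fibres_le _ _ P _ (fun z t => prefix z t)) => [z zs _|t ts Pt].
    by rewrite cz.
  exists (take j t); last by rewrite Pt prefix_take_le.
  by rewrite mem_words tk.
apply: (@count_fibres_ge _ _ P _ (fun z t => prefix z t)); first exact: words_uniq.
  move=> z zs Pz; rewrite -(cz z zs); apply: sub_count => t zt.
  by rewrite (pre z t) ?Pz //; apply/eqP; rewrite -mem_words.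
move=> t z z'; rewrite !mem_words => /eqP sz /eqP sz' _ _ zt z't.
by apply: prefix_eqsize zt z't _; rewrite sz sz'.
Qed.

Lemma cnt_extS j k (P Q : pred (seq X)) : j <= k ->
  (forall w, size w = k -> P (take j w) -> Q w) -> d ^ (k - j) * cnt j P <= cnt k Q.
Proof.
by move=> jk PQ; rewrite -cnt_ext subnKC //; apply: cnt_le.
Qed.

Definition moved g : pred (seq X) := fun w => g w != w.

Lemma moved_conj k g h : cnt k (moved (g * h * g^-1)%g) = cnt k (moved h).
Proof.
rewrite -(cnt_perm k (moved (g * h * g^-1)%g) g); apply: eq_count => w.
by rewrite /moved !tautM tautK (inj_eq (@taut_inj _ g)).
Qed.

Lemma moved_agree k g h : agree k g h -> cnt k (moved g) = cnt k (moved h).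
Proof.
by move=> gh; apply: eq_in_count => w; rewrite mem_words /moved => /eqP /gh ->.
Qed.

Lemma moved_take g k w : k <= size w -> moved g (take k w) -> moved g w.
Proof.
move=> kw; apply: contra => /eqP E; apply/eqP.
by apply: (@taut_fix_prefix _ g _ (drop k w)); rewrite cat_take_drop.
Qed.

(* [b / a] bounds the proportion of words of length [k] moved by [g]. *)
Definition small (a b k : nat) G := [set g | G g /\ cnt k (moved g) * a <= b * d ^ k].

Section Group.
Variable G : set (taut X).
Hypotheses (sG : is_subgroup G) (ntG : G <> [set 1%g]) (trG : level_transitive G).
Hypothesis ristG : forall n : nat, fi (Rist_level G n) G.
Hypothesis srG : forall v, tsection v @` Stv G v = G.
Hypothesis primG : tree_primitive G.

Lemma d_gt1 : 1 < d.
Proof.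
have [x0 [x1 x01]] := two_letters sG ntG; rewrite (cardD1 x0) (cardD1 x1) !inE.
by have /eqP := x01; rewrite eq_sym => ->.
Qed.

Lemma d_gt0 n : 0 < d ^ n.
Proof. by rewrite expn_gt0 (ltnW d_gt1). Qed.

(** If [g] moves [w] of length [n], it moves [g w] too, hence everything below two vertices: a
    proportion of at least [2 / d ^ n]. The factor 2 lets the bound [d ^ -n] itself qualify. *)
Lemma small_fixlev a b k n g : n <= k -> b * d ^ n < 2 * a -> small a b k G g -> fixlev n g.
Proof.
move=> nk ab [Gg sm] w sw; apply/eqP; apply: contraLR sm => gw; rewrite -ltnNge.
pose P : pred (seq X) := pred2 w (g w).
have Pc : 2 <= cnt n P.
  rewrite /cnt -size_filter; apply: (@uniq_leq_size _ [:: w; g w]).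
    by rewrite /= inE eq_sym gw.
  move=> u; rewrite mem_filter mem_words !inE => uP; rewrite [P u]uP andTb.
  by case/orP: uP => /eqP->; rewrite ?size_taut sw.
have le : d ^ (k - n) * cnt n P <= cnt k (moved g).
  apply: cnt_extS => // u su Pu; apply: (@moved_take g n); first by rewrite su.
  by case/orP: Pu => /eqP->; rewrite /moved ?(inj_eq (@taut_inj _ g)).
apply: (@leq_trans (d ^ (k - n) * 2 * a)); last first.
  by rewrite leq_mul2r (leq_trans _ le) ?orbT // leq_mul2l Pc orbT.
rewrite -{1}(subnK nk) expnD mulnCA -mulnA ltn_mul2l ab andbT; exact: d_gt0.
Qed.

(** Extensions of moved words are moved, so the proportion moved never decreases with the level. *)
Lemma smallS a b k : small a b k.+1 G `<=` small a b k G.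
Proof.
move=> g [Gg sm]; split=> //.
have le : d ^ (k.+1 - k) * cnt k (moved g) <= cnt k.+1 (moved g).
  apply: cnt_extS => // w sw; apply: moved_take; by rewrite sw.
rewrite subSnn expn1 in le; rewrite expnS in sm.
have d0 : 0 < d by rewrite (ltnW d_gt1).
rewrite -(leq_pmul2l d0) mulnA; apply: leq_trans (leq_mul le (leqnn a)) _.
by rewrite mulnCA.
Qed.

Definition smallgen a b k := generated (small a b k G).

Lemma smallgen_subgroup a b k : is_subgroup (smallgen a b k).
Proof. exact: generated_subgroup. Qed.

Lemma smallgenS a b k : smallgen a b k.+1 `<=` smallgen a b k.
Proof.
apply: generated_min; first exact: smallgen_subgroup.
by move=> g /smallS; apply: generated_sub.
Qed.

Lemma smallgen_conj a b k g h : G g -> smallgen a b k h -> smallgen a b k (g * h * g^-1)%g.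
Proof.
move=> Gg; pose M := [set h | smallgen a b k (g * h * g^-1)%g].
have sA := smallgen_subgroup a b k.
suff: smallgen a b k `<=` M by apply.
apply: generated_min.
  apply: is_subgroupP.
  - by rewrite /M /= mulg1 mulgV; apply: sub1.
  - move=> x Mx; rewrite /M /=; have := subV sA Mx.
    by rewrite !invgM invgK mulgA.
  - move=> x y Mx My; rewrite /M /=; have := subM sA Mx My.
    by rewrite !mulgA mulgVK.
move=> x [Gx sm]; apply: generated_sub; split; last by rewrite moved_conj.
by do ?apply: (subM sG) => //; apply: (subV sG).
Qed.

(** The orbits of [smallgen a b k] on level [k] are the trees at level [m], the only shape allowed
    by [tree_primitive]. The group varies with [k], where smallness is measured. *)
Definition orbit_level a b k m := [/\ m <= k,
  forall g, smallgen a b k g -> fixlev m g &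
  forall w t t', size w = m -> size t = k - m -> size t' = k - m ->
    exists2 g, smallgen a b k g & g (w ++ t) = w ++ t'].

Lemma orbit_level_exists a b k : exists m, orbit_level a b k m.
Proof.
have sA := smallgen_subgroup a b k.
pose orb u : set (seq X) := [set w | exists2 g, smallgen a b k g & g u = w].
have orbE u w : orb u w -> orb w = orb u.
  move=> [g Ag gu]; apply/seteqP; split=> z [h Ah hz].
    by exists (h * g)%g; [apply: (subM sA)|rewrite tautM gu].
  by exists (h * g^-1)%g; [apply: (subM sA) => //; apply: (subV sA)|rewrite tautM -gu tautK].
have orb_id u : orb u u by exists 1%g; [apply: (sub1 sA)|].
pose P : set (set (seq X)) := [set orb u | u in @level X k].
have partP : partition P id (@level X k).
  split.
  - apply/seteqP; split=> [w [_ [u su <-] [g _ <-]]|w sw]; first by rewrite /level /= size_taut.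
    by exists (orb w) => //; exists w.
  - move=> _ _ [u su <-] [w sw <-] [z [/orbE <- /orbE <-]] //.
  - by move=> _ [u su <-]; exists u.
have invP : invariant_partition G P.
  move=> g Gg.
  have gorb h u : G h -> h @` orb u = orb (h u).
    move=> Gh; apply/seteqP; split=> [_ [_ [r Ar <-] <-]|_ [r Ar <-]].
      exists (h * r * h^-1)%g; first exact: smallgen_conj.
      by rewrite !tautM tautK.
    exists (h^-1 (r (h u))); last by rewrite tautVK.
    exists (h^-1 * r * h)%g => //.
    by have := smallgen_conj (subV sG Gh) Ar; rewrite invgK.
  apply/seteqP; split=> [_ [_ [u su <-] <-]|_ [u su <-]].
    by rewrite gorb //; exists (g u) => //; rewrite /level /= size_taut.
  exists (orb (g^-1 u)); last by rewrite gorb // tautVK.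
  by exists (g^-1 u) => //; rewrite -su; exact: (size_taut g^-1 u).
have [m mk PE] := primG partP invP; exists m.
have cyl w t : size w = m -> size t = k - m -> orb (w ++ t) = [set w ++ t | t in @level X (k - m)].
  move=> sw st.
  have : P [set w ++ t | t in @level X (k - m)] by rewrite PE; exists w.
  move=> [u su E]; rewrite -E; apply/orbE.
  by rewrite E; exists t.
split=> //.
  move=> g Ag w sw; have [x0 _] := two_letters sG ntG.
  have : orb (w ++ nseq (k - m) x0) (g (w ++ nseq (k - m) x0)) by exists g.
  rewrite cyl ?size_nseq // => -[t _ E].
  by have := taut_take g w (nseq (k - m) x0); rewrite -E take_size_cat.
move=> w t t' sw st st'.
have : orb (w ++ t) (w ++ t') by rewrite cyl //; exists t'.
by case=> g Ag E; exists g.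
Qed.


Lemma split_fixlev N w k j : size w + k.+1 <= j -> (forall t t', size t = j - size w ->
  size t' = j - size w ->
   exists2 g, N g & g (w ++ t) = w ++ t') -> exists2 g, N g & ~ fixlev (size w + k.+1) g.
Proof.
move=> wj tr; have [x0 [x1 x01]] := two_letters sG ntG.
have j0 : j - size w = (j - size w).-1.+1 by lia.
have [||g Ng E] := tr (nseq (j - size w) x0) (nseq (j - size w) x1); rewrite ?size_nseq //.
exists g => // fg; have := fg (take (size w + k.+1) (w ++ nseq (j - size w) x0)).
rewrite size_takel; last by rewrite size_cat size_nseq; lia.
move=> /(_ erefl); rewrite taut1 => F.
have := taut_take g (take (size w + k.+1) (w ++ nseq (j - size w) x0)) (drop (size w + k.+1)
  (w ++ nseq (j - size w) x0)).
rewrite cat_take_drop E F size_takel; last by rewrite size_cat size_nseq; lia.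
by rewrite !takeD !drop_size_cat // !take_size_cat // => /catI; rewrite j0 /= => -[/esym].
Qed.

(** The groups shrink as [k] grows, so the orbits can only get finer. *)
Lemma orbit_level_le a b k m m' : orbit_level a b k m -> orbit_level a b k.+1 m' -> m <= m'.
Proof.
move=> [mk fm _] [m'k _ tr]; rewrite leqNgt; apply/negP => lt.
have [x0 _] := two_letters sG ntG.
have [||g /smallgenS/fm fg nfg] := @split_fixlev (smallgen a b k.+1) (nseq m' x0) 0 k.+1.
- by rewrite size_nseq; lia.
- by move=> t t' st st'; apply: tr; rewrite ?size_nseq // ?st ?st' size_nseq.
by apply: nfg; apply: (agree_le x0 fg); rewrite size_nseq addn1.
Qed.

(** [Rist_level] has finite index, and its sections at [w] are those of its factor [Ristv G w]. *)
Lemma fi_Ristv_section w : fi (tsection w @` Ristv G w) G.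
Proof.
have m : morph_on (tsection w) (Stv G w) by apply: tsection_morph => g [].
have sR : Ristv G w `<=` Stv G w by move=> g [Gg gw]; split=> //; apply: Sup_self.
have Rs : Rist_level G (size w) `<=` Stv G w.
  by move=> g /Rist_level_restr[] // Gg gn _; split=> //; apply: gn.
have sS := Stv_subgroup w sG.
have f : fi (Rist_level G (size w)) (Stv G w).
  have [_ [C [c cP]]] := ristG (size w); split=> //; exists C, c => x y [Gx _] [Gy _]; exact: cP.
have := fi_image sS m f; rewrite (srG w); apply: fi_between => [_ [g Rg <-]|].
  have [Gg gn gR] := Rist_level_restr sG Rg.
  by exists (restr w g); [apply: gR|rewrite tsection_graft].
by rewrite -[X in _ `<=` X](srG w); apply: image_subset.
Qed.

Lemma bounded_stable (f : nat -> nat) B : (forall k, f k <= f k.+1) -> (forall k, f k <= B) ->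
  exists K, forall k, K <= k -> f k = f K.
Proof.
move=> mono bd.
have ex : exists v : nat, `[< exists k, f k = v >] by exists (f 0); apply/asboolP; exists 0.
have ub (v : nat) : `[< exists k, f k = v >] -> v <= B by move=> /asboolP[k <-].
case: (ex_maxnP ex ub) => v /asboolP[K <-] mx; exists K => k Kk.
apply/eqP; rewrite eqn_leq mx /=; last by apply/asboolP; exists k.
by rewrite (homo_leq (leqnn) leq_trans mono).
Qed.

(** The levels do not decrease with [k]. They are bounded because the rigid stabiliser of a deep
    enough vertex consists of small elements and is transitive further down. *)
Lemma orbit_level_stable a b : 0 < b ->
  exists m K, forall k, K <= k -> orbit_level a b k m.
Proof.
move=> b0; have [f fP] := choice (orbit_level_exists a b).
have [x0 _] := two_letters sG ntG.
(* Depth [a] is enough: elements of [Ristv G w] move a proportion at most [d ^ -a], and [a <= d ^ a]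
   with [0 < b]. *)
pose w := nseq a x0; have sw : size w = a by rewrite size_nseq.
have sR : is_subgroup (tsection w @` Ristv G w).
  apply: image_subgroup (Ristv_subgroup sG w) _.
  by apply: tsection_morph => g [_]; apply: Sup_self.
have [e eP] := fi_below_trans sG ntG trG sR (fi_Ristv_section w).
have inA k : a <= k -> Ristv G w `<=` smallgen a b k.
  move=> ak g [Gg gw]; apply: generated_sub; split=> //.
  apply: (@leq_trans (d ^ (k - a) * a)).
    rewrite leq_mul2r; apply/orP; right.
    have -> : d ^ (k - a) = cnt k (prefix w) by rewrite -(cnt_prefix w) sw subnKC.
    by apply: cnt_le => u _; apply: contraR => /gw ->.
  rewrite -{2}(subnK ak) expnD mulnCA leq_mul2l.
  have le : a <= d ^ a by rewrite ltnW // ltn_expl // d_gt1.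
  by rewrite (leq_trans le) ?orbT // leq_pmull.
have fB k : f k <= a + e.
  rewrite leqNgt; apply/negP => lt; have [fk fix_ _] := fP k.
  pose y := w ++ nseq e x0.
  have sy : size y = a + e by rewrite size_cat sw size_nseq.
  have [||g Rg nfg] := @split_fixlev (Ristv G w) y 0 k.
  - by rewrite sy; lia.
  - move=> t t' st st'; have [||_ [g Rg <-] gt] := eP (nseq e x0) _ t t';
    rewrite ?size_nseq ?st ?st' //.
    exists g => //; rewrite /y -!catA tsection_eq ?gt //.
    by case: Rg => _; apply: Sup_self.
  have Ag : smallgen a b k g by apply: inA Rg; lia.
  by apply: nfg; rewrite sy; apply: (agree_le x0 (fix_ g Ag)); lia.
have [K KP] := bounded_stable (fun k => orbit_level_le (fP k) (fP k.+1)) fB.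
by exists (f K), K => k /KP <-.
Qed.

Lemma orbit_level_ge n k m : n <= k -> orbit_level (d ^ n) 1 k m -> n <= m.
Proof.
move=> nk [mk _ tr]; rewrite leqNgt; apply/negP => lt.
have [x0 _] := two_letters sG ntG.
have [||g Ag nfg] := @split_fixlev (smallgen (d ^ n) 1 k) (nseq m x0) 0 k.
- by rewrite size_nseq; lia.
- by move=> t t' st st'; apply: tr; rewrite ?size_nseq // ?st ?st' size_nseq.
apply: nfg; rewrite size_nseq; suff fn : fixlev n g by apply: (agree_le x0 fn); rewrite addn1.
suff : smallgen (d ^ n) 1 k `<=` fixlev n by apply.
apply: generated_min; first exact: fixlev_subgroup.
by move=> h; apply: small_fixlev => //; have := d_gt0 n; lia.
Qed.

(** An element moving at most [d ^ -(n - size y)] of the tree at [y] moves at most [d ^ -n] of the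
    whole when extended trivially. By [fi_dense] it agrees, up to a given level, with a section of
    an element of [Ristv G y]; so orbits in the subtree lie inside orbits of the whole tree. *)
Lemma orbit_level_below y : exists n0, forall n, n0 <= n -> size y <= n /\ forall m m',
  (exists K, forall k, K <= k -> orbit_level (d ^ n) 1 k m) ->
  (exists K, forall k, K <= k -> orbit_level (d ^ (n - size y)) 1 k m') ->
  m <= size y + m'.
Proof.
have [x0 _] := two_letters sG ntG.
have mor : morph_on (tsection y) (Ristv G y).
  by apply: tsection_morph => g [_]; apply: Sup_self.
have sR := image_subgroup (Ristv_subgroup sG y) mor.
have [r rP] := fi_dense sG ntG sR (fi_Ristv_section y).
(* With [n - size y] at least [r], small elements of the subtree fix level [r], as [fi_dense]
   asks. *)
exists (size y + r) => n yn; split; first lia.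
move=> m m' [K KP] [K' KP']; rewrite leqNgt; apply/negP => lt.
pose k := (K + K' + size y + n + m)%N; pose j := (k - size y)%N.
have jk : k = (size y + j)%N by rewrite /j; lia.
have [_ fixm _] := KP k ltac:(lia).
have [m'j _ tr] := KP' j ltac:(lia).
pose M := [set g | exists2 h, smallgen (d ^ n) 1 k h & h y = y /\ agree j (tsection y h) g].
have sA := smallgen_subgroup (d ^ n) 1 k.
have AM : smallgen (d ^ (n - size y)) 1 j `<=` M.
  apply: generated_min.
    apply: is_subgroupP.
    - exists 1%g; first exact: sub1; split=> // w _.
      by apply: (@catI _ y); rewrite -tsection_eq.
    - move=> g [h Ah [hy hg]]; exists h^-1; first exact: (subV sA).
      have hy' : h^-1 y = y by apply: tautV_fix.
      split=> // w sw; apply: (@taut_inj _ g); rewrite tautVK -hg ?size_taut //.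
      by apply: (@catI _ y); rewrite -!tsection_eq // tautVK.
    - move=> g1 g2 [h1 A1 [hy1 E1]] [h2 A2 [hy2 E2]]; exists (h1 * h2)%g; first exact: (subM sA).
      split; first by rewrite tautM hy2.
      by move=> w sw; rewrite tsectionMfix // !tautM E2 // E1 // size_taut.
  move=> g sg.
  have fg : fixlev r g.
    by apply: small_fixlev sg; [lia|have := leq_pexp2l (ltnW d_gt1) (_ : r <= n - size y);
      have := d_gt0 r; lia].
  have [Gg cg] := sg.
  have [_ [h [Gh hS] <-] hg] := rP g j Gg fg.
  have hy : h y = y by apply: Sup_self.
  exists h => //; apply: generated_sub; split=> //.
  apply: (@leq_trans (cnt j (moved g) * d ^ n)).
    rewrite leq_mul2r; apply/orP; right; rewrite -(moved_agree hg)
      {1}jk -(cnt_below y j (moved (tsection y h))).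
    apply: cnt_le => w sw mw.
    have yw : prefix y w by apply: contraR mw => /hS E; rewrite /moved E eqxx.
    rewrite yw /=; apply: contra mw => /eqP E; rewrite /moved -(prefix_drop yw) tsection_eq // E.
    by rewrite eqxx.
  rewrite mul1n jk expnD; have -> : d ^ n = d ^ size y * d ^ (n - size y).
    by rewrite -expnD subnKC //; lia.
  by rewrite mulnCA leq_mul2l -[d ^ j]mul1n cg orbT.
pose w := nseq m' x0.
have [||g Ag nfg] := @split_fixlev (smallgen (d ^ (n - size y)) 1 j) w 0 j.
- by rewrite size_nseq; lia.
- by move=> t t' st st'; apply: tr; rewrite ?size_nseq // ?st ?st' size_nseq.
apply: nfg; have [h Ah [hy hg]] := AM g Ag.
rewrite size_nseq => u su.
have ju : m' + 1 <= j by rewrite /j /k; lia.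
rewrite -(agree_le x0 hg ju su); apply: (@catI _ y); rewrite -tsection_eq // taut1.
have um : size y + (m' + 1) <= m by lia.
by rewrite (agree_le x0 (fixm h Ah) um) // size_cat su.
Qed.

End Group.
End Small.

(** * Rigidity of links *)

Section Rigidity.
Local Open Scope nat_scope.
Variable X : finType.
Implicit Types (u v w z y t p q s : seq X) (g h : taut X) (H L N : set (taut X)).
Local Notation d := #|X|.

Lemma lift_generated (K N : set (taut X)) w k :
  is_subgroup K -> (forall h, K h -> h w = w) ->
  (forall g, N g -> exists2 h, K h & agree k (tsection w h) g) ->
  forall g, generated N g -> exists2 h, K h & agree k (tsection w h) g.
Proof.
move=> sK Kw NP; pose M := [set g | exists2 h, K h & agree k (tsection w h) g].
suff: generated N `<=` M by [].
apply: generated_min => //; apply: is_subgroupP.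
- exists 1%g; first exact: sub1; move=> u _.
  by apply: (@catI _ w); rewrite -tsection_eq.
- move=> g [h Kh hg]; exists h^-1; first exact: subV.
  have hw := Kw h Kh; have hw' : h^-1 w = w by apply: tautV_fix.
  move=> u su; apply: (@taut_inj _ g); rewrite tautVK -hg ?size_taut //.
  by apply: (@catI _ w); rewrite -!tsection_eq // tautVK.
- move=> g1 g2 [h1 K1 E1] [h2 K2 E2]; exists (h1 * h2)%g; first exact: subM.
  by move=> u su; rewrite tsectionMfix ?Kw // !tautM E2 // E1 // size_taut.
Qed.

Section Group.
Variable G : set (taut X).
Hypotheses (sG : is_subgroup G) (ntG : G <> [set 1%g]) (trG : level_transitive G).
Hypothesis ristG : forall n : nat, fi (Rist_level G n) G.
Hypotheses (fgG : fg G) (torG : forall g, G g -> exists2 n : nat, (0 < n)%N & g ^+ n = 1%g).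
Hypothesis srG : forall v, tsection v @` Stv G v = G.
Hypothesis primG : tree_primitive G.

Section Pair.
Variables (H : set (taut X)) (v v' q0 y : seq X).
Hypotheses (sH : is_subgroup H) (fH : full G H v) (fH' : full G H v').
Hypothesis L0 : link H v (v' ++ q0).
Hypothesis L0' : link H (v' ++ q0) (v ++ y).
(** Homogeneity on either side: it makes the fibres of the matching over words of equal length
    equally large. *)
Hypothesis tr1 : forall z z', size z = size z' ->
  exists2 h, H h & h (v' ++ q0 ++ z) = v' ++ q0 ++ z'.
Hypothesis tr2 : forall t t', size t = size t' ->
  exists2 h, Stv H (v' ++ q0) h & h (v ++ y ++ t) = v ++ y ++ t'.

(* Under the matching of the two boundaries, [ln1 z t] says that the subtree at
   [v ++ t] is mapped into the one at [v' ++ q0 ++ z], and [ln2 t z] that the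
   latter is mapped back into the former. *)
Let ln1 z t := link H (v' ++ q0 ++ z) (v ++ t).
Let ln2 t z := link H (v ++ t) (v' ++ q0 ++ z).
Let L1 z : pred (seq X) := fun t => `[< ln1 z t >].
Let L2 t : pred (seq X) := fun z => `[< ln2 t z >].

Let vF h : H h -> h v = v. Proof. exact: fH.1. Qed.
Let vF' h : H h -> h v' = v'. Proof. exact: fH'.1. Qed.

Let cmp1 z z' t : ln1 z t -> ln1 z' t -> prefix z z' || prefix z' z.
Proof.
by move=> A B; have := link_comparable sG ntG trG ristG fgG torG srG sH fH fH' A B;
  rewrite !prefix_cat2l.
Qed.
Let cmp2 t t' z : ln2 t z -> ln2 t' z -> prefix t t' || prefix t' t.
Proof.
move=> A B; exact: (link_comparable sG ntG trG ristG fgG torG srG sH fH' fH A B).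
Qed.
Let uniq1 z z' t : ln1 z t -> ln1 z' t -> size z = size z' -> z = z'.
Proof.
by move=> A B E; case/orP: (cmp1 A B) => /prefix_size_eq F; [|apply/esym]; apply: F; rewrite E.
Qed.
Let uniq2 t t' z : ln2 t z -> ln2 t' z -> size t = size t' -> t = t'.
Proof.
by move=> A B E; case/orP: (cmp2 A B) => /prefix_size_eq F; [|apply/esym]; apply: F; rewrite E.
Qed.
Let comp21 t z t' : ln2 t z -> ln1 z t' -> prefix t t'.
Proof. by move=> A B; apply: (link_inv sG ntG trG ristG sH fH (link_trans A B)). Qed.
Let back2 t z : ln2 t z -> exists s, ln1 z (t ++ s).
Proof. by move=> A; apply: (link_back sG ntG trG ristG fgG torG srG sH fH fH' A). Qed.
Let ext1 z t s : ln1 z t -> ln1 z (t ++ s).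
Proof. by move=> A; apply: link_trans A _; rewrite catA; apply: link_cat. Qed.
Let ext2 t z s : ln2 t z -> ln2 t (z ++ s).
Proof. by move=> A; apply: link_trans A _; rewrite !catA; apply: link_cat. Qed.
Let res1 z s t : ln1 (z ++ s) t -> ln1 z t.
Proof. by apply: link_trans; rewrite !catA; apply: link_cat. Qed.
Let top1 z t : ln1 z t -> ln1 [::] t.
Proof. exact: (@res1 [::] z t). Qed.
Let res2 t s z : ln2 (t ++ s) z -> ln2 t z.
Proof. by apply: link_trans; rewrite catA; apply: link_cat. Qed.
Let ln0 : ln1 [::] y. Proof. by rewrite /ln1 cats0. Qed.
Let pre1 t : prefix y t -> ln1 [::] t.
Proof. by move=> /prefixP[s ->]; apply: ext1. Qed.

Let act1 h z t : H h -> h (v' ++ q0) = v' ++ q0 -> ln1 z t ->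
  ln1 (tsection (v' ++ q0) h z) (tsection v h t).
Proof.
by move=> Hh hx /(link_act sH Hh); rewrite (catA v') (tsectionP (v' ++ q0)) (tsectionP v)
  hx vF // -catA.
Qed.
Let act2 h z t : H h -> h (v' ++ q0) = v' ++ q0 -> ln2 t z ->
  ln2 (tsection v h t) (tsection (v' ++ q0) h z).
Proof.
by move=> Hh hx /(link_act sH Hh); rewrite (catA v') (tsectionP (v' ++ q0)) (tsectionP v)
  hx vF // -catA.
Qed.

(** The matched part of the tree at [v] is clopen: for long words, membership is decided by the
    first [e] letters. *)
Let clopen1 : exists e, size y <= e /\ forall t s, e <= size t -> ln1 [::] (t ++ s) -> ln1 [::] t.
Proof.
have sK := Stv_subgroup (v' ++ q0) sH.
have fK : full G (Stv H (v' ++ q0)) v by apply: full_fi sH (fi_Stv _ sH) fH.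
have [e eP] := trans_below sG ntG trG sK fK.
exists (maxn e (size y)); rewrite leq_maxr; split=> // t s; rewrite geq_max => /andP[te _].
rewrite /ln1 cats0 catA; apply: (link_up sG ntG sH) => [x Kx|t1 t2 /(eP t te)[h Kh ht]];
  first exact: Kx.
by exists h; rewrite // -!catA.
Qed.

Let clopen2 : exists e, forall z s, e <= size z -> ln2 y (z ++ s) -> ln2 y z.
Proof.
have sK := Stv_subgroup (v ++ y) sH.
have fK : full G (Stv H (v ++ y)) v' by apply: full_fi sH (fi_Stv _ sH) fH'.
have [e eP] := trans_below sG ntG trG sK fK.
exists e => z s ze; rewrite /ln2 (catA q0) catA.
apply: (link_up sG ntG sH) => [x Kx|t1 t2 E]; first exact: Kx.
have [|h Kh ht] := eP (q0 ++ z) _ t1 t2 E; first by rewrite size_cat (leq_trans ze) // leq_addl.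
by exists h; rewrite // -!(catA v').
Qed.

(** Long matched words determine the first [K'] letters of their image, by [link_split] at the
    finitely many matched words of length [e]. *)
Let split1 K' : exists k0, forall k, k0 <= k -> forall t, size t = k -> ln1 [::] t ->
  exists2 z, size z = K' & ln1 z t.
Proof.
have [e [_ eP]] := clopen1.
have [n nP] : exists n, forall t0, t0 \in words X e -> forall k, n <= k ->
    ln1 [::] t0 -> forall s, size s = k -> exists2 z, size z = K' & ln1 z (t0 ++ s).
  apply: choose_bound => t0 _; case: (pselect (ln1 [::] t0)) => [l0|]; last by exists 0.
  have [n nP] := link_split sG ntG trG ristG srG K' sH fH l0.
  exists n => k nk _ s sk; have [|z sz lz] := nP s; first by rewrite sk.
  by exists z => //; move: lz; rewrite cats0.
exists (e + n) => k ek t st lt.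
have lt0 : ln1 [::] (take e t).
  by apply: (eP _ (drop e t)); rewrite ?cat_take_drop // size_takel // st; lia.
have := nP (take e t) _ (k - e) _ lt0 (drop e t).
rewrite cat_take_drop mem_words size_takel ?size_drop ?st; last by lia.
by apply => //; lia.
Qed.

Let split2 j : exists k0, forall k, k0 <= k -> forall z, size z = k -> ln2 y z ->
  exists2 t, size t = j & ln2 (y ++ t) z.
Proof.
have [e eP] := clopen2.
have [n nP] : exists n, forall z0, z0 \in words X e -> forall k, n <= k ->
    ln2 y z0 -> forall s, size s = k -> exists2 t, size t = j & ln2 (y ++ t) (z0 ++ s).
  apply: choose_bound => z0 _; case: (pselect (ln2 y z0)) => [l0|]; last by exists 0.
  have [n nP] := link_split sG ntG trG ristG srG j sH fH' l0.
  exists n => k nk _ s sk; have [|t st lt] := nP s; first by rewrite sk.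
  by exists t => //; move: lt; rewrite -catA.
exists (e + n) => k ek z sz lz.
have lz0 : ln2 y (take e z).
  by apply: (eP _ (drop e z)); rewrite ?cat_take_drop // size_takel // sz; lia.
have := nP (take e z) _ (k - e) _ lz0 (drop e z).
rewrite cat_take_drop mem_words size_takel ?size_drop ?sz; last by lia.
by apply => //; lia.
Qed.

Let split0 j : exists k0, forall z, k0 <= size z -> exists2 t, size t = j & ln2 t z.
Proof.
have l : link H (v ++ [::]) (v' ++ q0) by rewrite cats0.
have [n nP] := link_split sG ntG trG ristG srG j sH fH' l.
by exists n => z /nP[t st lt]; exists t.
Qed.

Let x0 : X. Proof. by have [x _] := cid (two_letters sG ntG). Qed.

Section Levels.
Variables (e e2 : nat).
Hypotheses (ye : size y <= e) (eP : forall t s, e <= size t -> ln1 [::] (t ++ s) -> ln1 [::] t).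
Hypothesis e2P : forall z s, e2 <= size z -> ln2 y (z ++ s) -> ln2 y z.
Let b := cnt e (L1 [::]).
Let b2 := cnt e2 (L2 y).

Let b_gt0 : 0 < b.
Proof.
rewrite /b -has_count; apply/hasP; exists (y ++ nseq (e - size y) x0).
  by rewrite mem_words size_cat size_nseq subnKC.
by apply/asboolP/ext1.
Qed.

Let cnt1 k : e <= k -> cnt k (L1 [::]) = d ^ (k - e) * b.
Proof.
move=> ek; rewrite -cnt_ext subnKC //; apply: eq_in_count => t; rewrite mem_words => /eqP st.
apply/asboolP/asboolP => lt; last by rewrite -(cat_take_drop e t); apply: ext1.
by apply: (eP (s := drop e t)); rewrite ?cat_take_drop // size_takel // st.
Qed.

Let cnt2 k : e2 <= k -> cnt k (L2 y) = d ^ (k - e2) * b2.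
Proof.
move=> ek; rewrite -cnt_ext subnKC //; apply: eq_in_count => t; rewrite mem_words => /eqP st.
apply/asboolP/asboolP => lt; last by rewrite -(cat_take_drop e2 t); apply: ext2.
by apply: (e2P (s := drop e2 t)); rewrite ?cat_take_drop // size_takel // st.
Qed.

Let fib1 k z z' : size z = size z' -> cnt k (L1 z) = cnt k (L1 z').
Proof.
move=> zz'; have [h Hh hz] := tr1 zz'.
have hx : h (v' ++ q0) = v' ++ q0.
  have := taut_take h (v' ++ q0) z; rewrite -catA hz catA take_size_cat //.
have hz' : tsection (v' ++ q0) h z = z'.
  by apply: (@catI _ (v' ++ q0)); rewrite -tsection_eq // -catA hz catA.
rewrite -(cnt_perm k (L1 z') (tsection v h)); apply: eq_count => t.
apply/asboolP/asboolP => [/(act1 Hh hx)|lt]; first by rewrite hz'.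
have hVx : h^-1 (v' ++ q0) = v' ++ q0 by apply: tautV_fix.
have := act1 (subV sH Hh) hVx lt.
have -> : tsection v h^-1 (tsection v h t) = t.
  by apply: (@catI _ v); rewrite -!tsection_eq ?tautK ?vF //; apply: subV.
suff -> : tsection (v' ++ q0) h^-1 z' = z by [].
by rewrite -hz'; apply: (@catI _ (v' ++ q0)); rewrite -!tsection_eq ?tautK.
Qed.

Let fib2 k t t' : size t = size t' -> cnt k (L2 (y ++ t)) = cnt k (L2 (y ++ t')).
Proof.
move=> tt'; have [h [Hh hx] ht] := tr2 tt'.
have ht' : tsection v h (y ++ t) = y ++ t'.
  by apply: (@catI _ v); rewrite -tsection_eq ?vF.
rewrite -(cnt_perm k (L2 (y ++ t')) (tsection (v' ++ q0) h)); apply: eq_count => z.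
apply/asboolP/asboolP => [/(act2 Hh hx)|lz]; first by rewrite ht'.
have hVx : h^-1 (v' ++ q0) = v' ++ q0 by apply: tautV_fix.
have := act2 (subV sH Hh) hVx lz.
have -> : tsection v h^-1 (y ++ t') = y ++ t.
  by rewrite -ht'; apply: (@catI _ v); rewrite -!tsection_eq ?tautK ?vF //; apply: subV.
suff -> : tsection (v' ++ q0) h^-1 (tsection (v' ++ q0) h z) = z by [].
by apply: (@catI _ (v' ++ q0)); rewrite -!tsection_eq ?tautK.
Qed.

Let splits1 K' k := forall t, size t = k -> ln1 [::] t -> exists2 z, size z = K' & ln1 z t.
Let splits2 j K' := forall z, size z = K' -> ln2 y z -> exists2 t, size t = j & ln2 (y ++ t) z.

(** The fibres over words of length [K'] have equal size by [fib1], are disjoint by [uniq1] and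
    cover the matched part by [splits1], so each holds an equal share. *)
Let fibre1 K' k z : e <= k -> splits1 K' k -> size z = K' -> cnt k (L1 z) * d ^ K' = d ^ (k - e)
  * b.
Proof.
move=> ek sp sz; rewrite -cnt1 // -(size_words X K') -(count_predT (words X K')).
have cz z' : z' \in words X K' -> cnt k (L1 z') = cnt k (L1 z).
  by rewrite mem_words => /eqP sz'; apply: fib1; rewrite sz sz'.
apply/eqP; rewrite eqn_leq; apply/andP; split.
  apply: (@count_fibres_ge _ _ predT _ L1); first exact: words_uniq.
    move=> z' zs _; rewrite -(cz z' zs); apply: sub_count => t /asboolP lt.
    by apply/andP; split; apply/asboolP => //; apply: top1 lt.
  move=> t z1 z2; rewrite !mem_words => /eqP s1 /eqP s2 _ _ /asboolP l1 /asboolP l2.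
  by apply: uniq1 l1 l2 _; rewrite s1 s2.
apply: (@count_fibres_le _ _ predT _ L1) => [z' zs _|t]; first by rewrite -(cz z' zs).
rewrite mem_words => /eqP st /asboolP lt; have [z' sz' lz'] := sp t st lt.
by exists z'; rewrite ?mem_words ?sz' //; apply/asboolP.
Qed.

Let fibre2 j K' t : e2 <= K' -> splits2 j K' -> size t = j ->
  cnt K' (L2 (y ++ t)) * d ^ j = d ^ (K' - e2) * b2.
Proof.
move=> ek sp st; rewrite -cnt2 // -(size_words X j) -(count_predT (words X j)).
have ct t' : t' \in words X j -> cnt K' (L2 (y ++ t')) = cnt K' (L2 (y ++ t)).
  by rewrite mem_words => /eqP st'; apply: fib2; rewrite st st'.
apply/eqP; rewrite eqn_leq; apply/andP; split.
  apply: (@count_fibres_ge _ _ predT _ (fun t => L2 (y ++ t))); first exact: words_uniq.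
    move=> t' ts _; rewrite -(ct t' ts); apply: sub_count => z /asboolP lz.
    by apply/andP; split; apply/asboolP => //; apply: res2 lz.
  move=> z t1 t2; rewrite !mem_words => /eqP s1 /eqP s2 _ _ /asboolP l1 /asboolP l2.
  by apply: (@catI _ y); apply: uniq2 l1 l2 _; rewrite !size_cat s1 s2.
apply: (@count_fibres_le _ _ predT _ (fun t => L2 (y ++ t))) => [t' ts _|z];
  first by rewrite -(ct t' ts).
rewrite mem_words => /eqP sz /asboolP lz; have [t' st' lt'] := sp z sz lz.
by exists t'; rewrite ?mem_words ?st' //; apply/asboolP.
Qed.

(* [b / d ^ e] is the density in the tree at [v] of the image of the tree at
   [v' ++ q0], and [b2 / d ^ e2] that of the subtree at [v ++ y] in the latter. *)
Let density : d ^ (e + e2) <= b * b2 * d ^ size y.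
Proof.
have d0 n := d_gt0 sG ntG n.
have [k1 k1P] := split0 (size y).
pose K' := k1 + e2.
have [k2 k2P] := split1 K'.
pose k := (k2 + e)%N; have sp : splits1 K' k by apply: k2P; rewrite /k; lia.
pose z0 := nseq K' x0; have sz0 : size z0 = K' by rewrite size_nseq.
have F := fibre1 (leq_addl _ _ : e <= k) sp sz0.
(* The words below [y] are covered by the fibres over those [z] to which [y] is linked. *)
have le : d ^ (k - size y) <= cnt k (L1 z0) * cnt K' (L2 y).
  have {1}-> : d ^ (k - size y) = cnt k (prefix y).
    by rewrite -(cnt_prefix y) subnKC // /k; lia.
  apply: (@count_fibres_le _ _ (L2 y) (prefix y) L1) => [z|t].
    by rewrite mem_words => /eqP sz _; rewrite -(fib1 k (z := z) (z' := z0)) // sz sz0.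
  rewrite mem_words => /eqP st yt; have [z sz lz] := sp t st (pre1 yt).
  exists z; rewrite ?mem_words ?sz //; apply/andP; split; apply/asboolP => //.
  have [|t0 st0 lt0] := k1P z; first by rewrite sz /K'; lia.
  by rewrite -(prefix_eqsize (comp21 lt0 lz) yt st0).
rewrite cnt2 in le; last by rewrite /K'; lia.
rewrite -(leq_pmul2r (d0 (k - size y))) -(mulnA (b * b2)) -(expnD d (size y)) subnKC;
  last by rewrite /k; lia.
rewrite mulnC; apply: (@leq_trans (cnt k (L1 z0) * (d ^ (K' - e2) * b2) * d ^ (e + e2))).
  by rewrite leq_mul2r le orbT.
have E1 : d ^ K' = d ^ (K' - e2) * d ^ e2 by rewrite -expnD subnK // /K'; lia.
have E2 : d ^ k = d ^ (k - e) * d ^ e by rewrite -expnD subnK // /k; lia.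
rewrite E1 in F; rewrite E2 expnD.
set A := d ^ (K' - e2) in F *; set B := d ^ e2 in F *; set C := d ^ (k - e) in F *.
set D := d ^ e in F *; set c := cnt k (L1 z0) in F *.
rewrite (_ : c * (A * b2) * (D * B) = c * (A * B) * b2 * D); last by lia.
by rewrite F; lia.
Qed.

(** If [h] moves [z], it moves the whole fibre of [z], so the proportion grows at most by
    [d ^ e / b]. Moving [v' ++ q0] would move the whole matched part, of proportion at least
    [d ^ -e], too much since [e < n]. *)
Let small12 K' k n h : e <= k -> splits1 K' k -> e < n -> H h ->
  cnt k (moved (tsection v h)) * d ^ n <= d ^ k ->
  h (v' ++ q0) = v' ++ q0 /\
  cnt K' (moved (tsection (v' ++ q0) h)) * (b * d ^ n) <= d ^ e * d ^ K'.
Proof.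
move=> ek sp en Hh sm; have d0 m := d_gt0 sG ntG m.
have E2 : d ^ k = d ^ (k - e) * d ^ e by rewrite -expnD subnK.
have hx : h (v' ++ q0) = v' ++ q0.
  apply: contrapT => hx.
  have le : cnt k (L1 [::]) <= cnt k (moved (tsection v h)).
    apply: cnt_le => t _ /asboolP lt; apply/eqP => ht; apply: hx.
    have := link_act sH Hh lt; rewrite (tsectionP v) vF // ht cats0 (tsectionP v') vF' // => lt'.
    have := link_comparable sG ntG trG ristG fgG torG srG sH fH fH' lt'.
    move: lt; rewrite /ln1 cats0 => lt /(_ _ lt) /orP[] /prefix_size_eq E; congr (_ ++ _);
      [|apply/esym]; apply: E; by rewrite size_taut.
  rewrite cnt1 // in le.
  have := leq_trans (leq_mul le (leqnn (d ^ n))) sm.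
  rewrite E2 -mulnA leq_pmul2l // leqNgt => /negP; apply.
  apply: (@leq_trans (d ^ n)); first by rewrite ltn_exp2l // (d_gt1 sG ntG).
  by rewrite leq_pmull.
split=> //.
pose z0 := nseq K' x0; have sz0 : size z0 = K' by rewrite size_nseq.
have le : cnt k (L1 z0) * cnt K' (moved (tsection (v' ++ q0) h)) <= cnt k (moved (tsection v h)).
  apply: (@count_fibres_ge _ _ _ _ L1); first exact: words_uniq.
    move=> z; rewrite mem_words => /eqP sz mz; rewrite (fib1 k (z' := z)) ?sz //.
    apply: cnt_le => t _ lt; rewrite lt andbT; apply: contra mz => /eqP ht.
    apply/eqP; move/asboolP: lt => lt.
    by have := act1 Hh hx lt; rewrite ht => /uniq1/(_ lt); rewrite size_taut; apply.
  move=> t z1 z2; rewrite !mem_words => /eqP s1 /eqP s2 _ _ /asboolP l1 /asboolP l2.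
  by apply: uniq1 l1 l2 _; rewrite s1 s2.
have F := fibre1 ek sp sz0.
have := leq_trans (leq_mul le (leqnn (d ^ n))) sm.
rewrite -(leq_pmul2r (d0 K')) E2.
set c := cnt k (L1 z0) in F *; set m := cnt K' _; set A := d ^ (k - e) in F *.
rewrite (_ : c * m * d ^ n * d ^ K' = A * (m * (b * d ^ n))).
  by rewrite -(mulnA A) leq_pmul2l //; exact: d0.
by rewrite -mulnA (mulnC (d ^ n)) mulnACA F -mulnA (mulnCA b).
Qed.

(** The same argument for the return, with factor [d ^ e2 / b2]. By [density] both factors together
    are at most [d ^ size y], whence the exponent [n - size y]. *)
Let small23 j K' n h : e2 <= K' -> splits2 j K' -> e + e2 < n ->
  Stv H (v' ++ q0) h ->
  cnt K' (moved (tsection (v' ++ q0) h)) * (b * d ^ n) <= d ^ e * d ^ K' ->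
  h (v ++ y) = v ++ y /\
  cnt j (moved (tsection (v ++ y) h)) * d ^ (n - size y) <= 1 * d ^ j.
Proof.
move=> ek sp en [Hh hx] sm; have d0 m := d_gt0 sG ntG m.
have E2 : d ^ K' = d ^ (K' - e2) * d ^ e2 by rewrite -expnD subnK.
have b20 : 0 < b2.
  by have := density; case: (b2) => //; rewrite muln0 mul0n leqNgt d0.
have hvy : h (v ++ y) = v ++ tsection v h y by rewrite tsectionP vF.
have hy : tsection v h y = y.
  apply: contrapT => hy.
  have le : cnt K' (L2 y) <= cnt K' (moved (tsection (v' ++ q0) h)).
    apply: cnt_le => z _ /asboolP lz; apply/eqP => hz; apply: hy.
    by have := act2 Hh hx lz; rewrite hz => /uniq2/(_ lz); rewrite size_taut; apply.
  rewrite cnt2 // in le.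
  have := leq_trans (leq_mul le (leqnn (b * d ^ n))) sm.
  rewrite E2 (mulnCA (d ^ e)) -(mulnA _ b2) leq_pmul2l // leqNgt => /negP; apply.
  apply: (@leq_trans (d ^ n)).
    by rewrite -expnD ltn_exp2l // (d_gt1 sG ntG).
  by rewrite mulnA leq_pmull // muln_gt0 b20 b_gt0.
have hvy' : h (v ++ y) = v ++ y by rewrite hvy hy.
split=> //.
pose t0 := nseq j x0; have st0 : size t0 = j by rewrite size_nseq.
have ty t : tsection v h (y ++ t) = y ++ tsection (v ++ y) h t.
  by rewrite tsectionP hy tsection_cat.
have le : cnt K' (L2 (y ++ t0)) * cnt j (moved (tsection (v ++ y) h))
  <= cnt K' (moved (tsection (v' ++ q0) h)).
  apply: (@count_fibres_ge _ _ _ _ (fun t => L2 (y ++ t))); first exact: words_uniq.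
    move=> t; rewrite mem_words => /eqP st mt; rewrite (fib2 K' (t' := t)) ?st //.
    apply: cnt_le => z _ lz; rewrite lz andbT; apply: contra mt => /eqP hz.
    apply/eqP; move/asboolP: lz => lz; apply: (@catI _ y); rewrite -ty.
    by have := act2 Hh hx lz; rewrite hz => /uniq2/(_ lz); rewrite size_taut; apply.
  move=> z t1 t2; rewrite !mem_words => /eqP s1 /eqP s2 _ _ /asboolP l1 /asboolP l2.
  by apply: (@catI _ y); apply: uniq2 l1 l2 _; rewrite !size_cat s1 s2.
have F := fibre2 ek sp st0.
have := leq_trans (leq_mul le (leqnn (b * d ^ n))) sm.
rewrite -(leq_pmul2r (d0 j)) E2 mul1n.
set c := cnt K' (L2 _) in F *; set m := cnt j _; set A := d ^ (K' - e2) in F *.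
rewrite (_ : c * m * (b * d ^ n) * d ^ j = A * (m * (b * b2 * d ^ n))); last first.
  rewrite -mulnA (mulnC (b * d ^ n)) mulnACA F -mulnA; congr (_ * _).
  by rewrite mulnCA (mulnCA b2) (mulnA b).
rewrite (_ : d ^ e * (A * d ^ e2) * d ^ j = A * (d ^ (e + e2) * d ^ j));
  last by rewrite expnD -!mulnA (mulnCA (d ^ e)).
rewrite leq_pmul2l => [sm'|]; last exact: d0.
rewrite -(leq_pmul2l (d0 (e + e2))); apply: leq_trans _ sm'.
have yn : size y <= n by lia.
rewrite -{2}(subnK yn) (expnD d (n - size y)).
rewrite (_ : m * (b * b2 * (d ^ (n - size y) * d ^ size y)) = (b * b2 * d ^ size y)
  * (m * d ^ (n - size y))); last first.
  by rewrite (mulnC (d ^ (n - size y))) (mulnA (b * b2)) mulnCA.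
by rewrite leq_mul2r density orbT.
Qed.

(** Three orbit levels occur: [a] in the tree at [v] for the bound [d ^ -n], [a'] in the tree at
    [v' ++ q0] for its image [d ^ e / (b * d ^ n)], and [a0] below [v ++ y] for the bound after the
    return. *)
Lemma link_rigid_levels : exists n0, forall n, n0 <= n -> forall a,
  (exists K, forall k, K <= k -> orbit_level G (d ^ n) 1 k a) ->
  forall p, size p = a -> prefix y p -> exists q, J H (v ++ p) = J H (v' ++ q).
Proof.
pose x' := v' ++ q0; pose Kx := Stv H x'.
have sKx : is_subgroup Kx := Stv_subgroup x' sH.
have fKx : full G Kx x' := full_Stv sG srG q0 sH fH'.
have mKx := full_morph fKx.
have [n1 n1P] := fi_dense sG ntG (full_image sH fH) fH.2.
have [n2 n2P] := fi_dense sG ntG (full_image sKx fKx) fKx.2.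
have [n3 n3P] := orbit_level_below sG ntG ristG srG y.
(* [n1], [n2] and [e] make small elements of either tree fix the levels that [fi_dense] requires,
   [e] and [e2] serve [small12] and [small23], and [n3] the comparison of [a] with [a0]. *)
exists (n1 + n2 + n3 + e + e2 + 1) => n nn a [Ka KaP] p sp yp.
have [yn yB] := n3P n ltac:(lia).
have [a0 [K0 K0P]] := orbit_level_stable sG ntG trG ristG srG primG (d ^ (n - size y)) (ltn0Sn 0).
have aa0 : a <= size y + a0 by apply: yB; [exists Ka|exists K0].
have [a' [K' K'P]] := orbit_level_stable sG ntG trG ristG srG primG (b * d ^ n) (d_gt0 sG ntG e).
pose j := a0 + K0.
have [k2 k2P] := split2 j; have [k3 k3P] := split0 a.
pose K1 := K' + a' + k2 + k3 + e2 + n2.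
have [k4 k4P] := split1 K1.
have [a'K1 fix' tr'] := K'P K1 ltac:(rewrite /K1; lia).
have [a0j fix0 _] := K0P j ltac:(rewrite /j; lia).
have sp2 : splits2 j K1 by apply: k2P; rewrite /K1; lia.
have dn m m' : m <= m' -> 1 * d ^ m < 2 * d ^ m'.
  move=> mm; have := leq_pexp2l (ltnW (d_gt1 sG ntG)) mm; have := d_gt0 sG ntG m; lia.
have meet k t : k4 <= k -> size t = k -> prefix p t ->
    exists2 z, size z = K1 & ln2 p z /\ ln1 z t.
  move=> kk st pt; have [z sz lz] := k4P k kk t st (pre1 (prefix_trans yp pt)).
  exists z => //; split=> //; have [|t0 st0 lt0] := k3P z; first by rewrite sz /K1; lia.
  by rewrite (prefix_eqsize pt (comp21 lt0 lz)) ?sp ?st0.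
have [z1 sz1 [lz1 _]] := meet _ (p ++ nseq k4 x0) (leq_addl a k4)
  ltac:(by rewrite size_cat size_nseq sp) (prefix_prefix _ _).
pose w' := take a' z1.
have sw' : size w' = a' by rewrite size_takel // sz1.
have w'z1 : prefix w' z1 by apply: prefix_take_le.
(* Small elements of the first tree are transitive below [p] and, being small
   on the second tree, fix [w']; so [p] is only linked to words below [w'].
   Conversely small elements of the second tree are transitive below [w'] and
   fix [p]. *)
have inner z2 : size z2 = K1 -> ln2 p z2 -> prefix w' z2.
  move=> sz2 lz2; have [s1 l1] := back2 lz1; have [s2 l2] := back2 lz2.
  pose k := Ka + a + n + k4 + e + n1 + size s1 + size s2.
  pose u1 := s1 ++ nseq (k - a - size s1) x0; pose u2 := s2 ++ nseq (k - a - size s2) x0.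
  have su1 : size u1 = k - a by rewrite size_cat size_nseq /k; lia.
  have su2 : size u2 = k - a by rewrite size_cat size_nseq /k; lia.
  have m1 : ln1 z1 (p ++ u1) by rewrite catA; apply: ext1.
  have m2 : ln1 z2 (p ++ u2) by rewrite catA; apply: ext1.
  have [_ _ tr] := KaP k ltac:(rewrite /k; lia).
  have [g Ag gu] := tr p u1 u2 sp su1 su2.
  (* Fixing level [a'] is built into [K]: it is checked on small generators and must survive
     products. *)
  pose K := [set h | Kx h /\ fixlev a' (tsection x' h)].
  have sK : is_subgroup K := preimage_subgroup sKx mKx (fixlev_subgroup _ a').
  have sp1 : splits1 K1 k by apply: k4P; rewrite /k; lia.
  have [h [[Hh hx] ha'] hg] : exists2 h, K h & agree k (tsection v h) g.
    apply: (@lift_generated K (small (d ^ n) 1 k G) v k sK _ _ g Ag) => [h [[Hh _] _]|g1 sg];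
      first exact: vF.
    have fg1 : fixlev n1 g1.
      by apply: small_fixlev sg => //; [rewrite /k; lia|apply: dn; lia].
    have [_ [h Hh <-] hg] := n1P g1 k sg.1 fg1.
    exists h => //; have ek : e <= k by rewrite /k; lia.
    have [||hx ch] := small12 ek sp1 _ Hh (n := n).
    - lia.
    - by rewrite (moved_agree hg) -[leqRHS]mul1n; apply: sg.2.
    have Kh : Kx h by split.
    split=> //; apply: fix'; apply: generated_sub; split=> //.
    by apply: fKx.2.1; exists h.
  have hz : tsection x' h z1 = z2.
    have := act1 Hh hx m1; rewrite hg ?gu; last by rewrite size_cat sp su1 /k; lia.
    by move/uniq1/(_ m2); rewrite size_taut; apply; rewrite sz1 sz2.
  have hw : tsection x' h w' = w' by apply: ha'.
  by rewrite -hz -{1}hw taut_prefix.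
have outer z2 : size z2 = K1 -> prefix w' z2 -> ln2 p z2.
  move=> sz2 wz2.
  have [|||g Ag gz] := tr' w' (drop a' z1) (drop a' z2); rewrite ?size_drop ?sz1 ?sz2 //.
  have z2E : w' ++ drop a' z2 = z2 by rewrite -sw' prefix_drop.
  rewrite z2E cat_take_drop in gz.
  pose K := Kx `&` [set h | h (v ++ p) = v ++ p].
  have sK : is_subgroup K := subgroupI sKx (stab_subgroup _).
  have [h [[Hh hx] hp] hg] : exists2 h, K h & agree K1 (tsection x' h) g.
    apply: (@lift_generated K (small (b * d ^ n) (d ^ e) K1 G) x' K1 sK _ _ g Ag) =>
      [h [[_ hx] _] //|g1 sg].
    have fg2 : fixlev n2 g1.
      apply: small_fixlev sg => //; first by rewrite /K1; lia.
      have := dn (e + n2) n ltac:(lia); rewrite expnD; have := b_gt0; nia.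
    have [_ [h Kh <-] hg] := n2P g1 K1 sg.1 fg2.
    exists h => //; split=> //; have ek : e2 <= K1 by rewrite /K1; lia.
    have [||hy ch] := small23 ek sp2 _ Kh (n := n).
    - lia.
    - by rewrite (moved_agree hg); apply: sg.2.
    have fh : fixlev a0 (tsection (v ++ y) h).
      apply: fix0; apply: generated_sub; split=> //.
      by apply: (full_Stv sG srG y sH fH).2.1; exists h => //; split=> //; case: Kh.
    (* The inequality [a <= size y + a0] places [p] at depth at most [a0] below [y], a level that
       [h] fixes. *)
    have [s E] := prefixP yp; rewrite /= E catA tsection_eq // (agree_le x0 fh (j := size s)) //.
    have := congr1 size E; rewrite size_cat sp; move: aa0; clear; move: (size s) (size y) => ? ?;
      lia.
  have hg1 : tsection x' h z1 = z2 by rewrite hg.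
  have := act2 Hh hx lz1; rewrite hg1.
  suff -> : tsection v h p = p by [].
  by apply: (@catI _ v); rewrite -tsection_eq ?vF.
exists (q0 ++ w'); apply/seteqP; split=> h hJ; (split; first exact: hJ.1).
  apply: (Fix_deep (k := K1 - a') x0) => c sc.
  have lc : ln2 p (w' ++ c) by apply: outer; rewrite ?prefix_prefix // size_cat sw' sc; lia.
  by have [_] := lc h hJ; rewrite -!catA.
apply: (Fix_deep (k := k4) x0) => c sc.
have [||z sz [lz lz']] := meet (a + k4) (p ++ c) _ _ (prefix_prefix _ _).
- exact: leq_addl.
- by rewrite size_cat sp sc.
have /prefixP[s E] := inner z sz lz.
have [_] : J H (v ++ p ++ c) h by apply: lz'; rewrite E !catA; apply: link_cat; rewrite -catA.
by rewrite catA.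
Qed.

End Levels.

Lemma link_rigid_pair : exists n0, forall n, n0 <= n -> forall a,
  (exists K, forall k, K <= k -> orbit_level G (d ^ n) 1 k a) ->
  forall p, size p = a -> prefix y p -> exists q, J H (v ++ p) = J H (v' ++ q).
Proof.
have [e [ye eP]] := clopen1; have [e2 e2P] := clopen2.
exact: link_rigid_levels ye eP e2P.
Qed.

End Pair.
End Group.
End Rigidity.

(** * Blocks *)

Section Blocks.
Variable X : finType.
Implicit Types (u v w z y t p q s : seq X) (g h : taut X) (H L N : set (taut X)).
Local Notation d := #|X|.

Section Group.
Variable G : set (taut X).
Hypotheses (sG : is_subgroup G) (ntG : G <> [set 1]) (trG : level_transitive G).
Hypothesis ristG : forall n : nat, fi (Rist_level G n) G.
Hypotheses (fgG : fg G) (torG : forall g, G g -> exists2 n : nat, (0 < n)%N & g ^+ n = 1).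
Hypothesis srG : forall v, tsection v @` Stv G v = G.
Hypothesis primG : tree_primitive G.

Definition stable_level n a := exists K, forall k, K <= k -> orbit_level G (d ^ n)%N 1 k a.

Lemma stable_level_ge n a : stable_level n a -> n <= a.
Proof.
move=> [K KP]; apply: (orbit_level_ge sG ntG (k := maxn n K)); first exact: leq_maxl.
by apply: KP; apply: leq_maxr.
Qed.

(** A link from [v ++ p] is also a link from [v], and links to long words climb to prefixes of fixed
    length. So only finitely many pairs [q0], [y] arise in [link_rigid_pair], and one bound serves
    all. *)
Lemma link_rigid H v v' : is_subgroup H -> full G H v -> full G H v' ->
  exists n0, forall n, n0 <= n -> forall a, stable_level n a -> forall p, size p = a ->
    (forall q, ~ link H (v ++ p) (v' ++ q)) \/ exists q, J H (v ++ p) = J H (v' ++ q).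
Proof.
move=> sH fH fH'; have [x0 _] := two_letters sG ntG.
have [m mP] := trans_below sG ntG trG sH fH'.
have up q0 z : m <= size q0 -> link H v (v' ++ q0 ++ z) -> link H v (v' ++ q0).
  move=> mq; rewrite catA; apply: (link_up (K := H) sG ntG sH).
    by move=> h Hh; split=> //; apply: fH.1.
  by move=> t t' /(mP q0 mq)[h Hh ht]; exists h; rewrite // -!catA.
have [n0 n0P] : exists n0, forall q0, q0 \in words X m -> forall n, n0 <= n ->
    forall a, stable_level n a -> forall p, size p = a ->
    (exists q, link H (v ++ p) (v' ++ q0 ++ q)) -> exists q, J H (v ++ p) = J H (v' ++ q).
  apply: choose_bound => q0; rewrite mem_words => /eqP sq0.
  case: (pselect (link H v (v' ++ q0))) => [l0|nl0]; last first.
    exists 0 => n _ a _ p _ [q l]; case: nl0; apply: (up q0 q); first by rewrite sq0.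
    by apply: link_trans l; apply: link_cat.
  have sK := Stv_subgroup (v' ++ q0) sH.
  have fK : full G (Stv H (v' ++ q0)) v by apply: full_fi sH (fi_Stv _ sH) fH.
  have [m2 m2P] := trans_below sG ntG trG sK fK.
  have [n1 n1P] : exists n1, forall y, y \in words X m2 -> forall n, n1 <= n ->
      link H (v' ++ q0) (v ++ y) -> forall a, stable_level n a ->
      forall p, size p = a -> prefix y p -> exists q, J H (v ++ p) = J H (v' ++ q).
    apply: choose_bound => y; rewrite mem_words => /eqP sy.
    case: (pselect (link H (v' ++ q0) (v ++ y))) => [l1|]; last by exists 0.
    have [||n1 n1P] := link_rigid_pair sG ntG trG ristG fgG torG srG primG sH fH fH' l0 l1.
    - by move=> z z'; apply: mP; rewrite sq0.
    - by move=> t t'; apply: m2P; rewrite sy.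
    by exists n1 => n nn _ a; apply: n1P.
  exists (maxn n1 m2) => n; rewrite geq_max => /andP[nn1 nm2] a sa p sp [q l].
  have ma : m2 <= size p by rewrite sp (leq_trans nm2) // (stable_level_ge sa).
  apply: (n1P (take m2 p) _ n nn1 _ a sa p sp (prefix_take_le _ _)).
    by rewrite mem_words size_takel.
  have [s ls] := link_back sG ntG trG ristG fgG torG srG sH fH fH' l.
  have l2 : link H (v' ++ q0) (v ++ take m2 p ++ drop m2 p ++ s).
    rewrite (catA (take m2 p)) cat_take_drop; apply: link_trans ls.
    by rewrite catA; apply: link_cat.
  move: l2; rewrite (catA v); apply: (link_up sG ntG sH) => [h Kh|t t']; first exact: Kh.
  move=> /(m2P (take m2 p)); rewrite size_takel // => /(_ (leqnn _))[h Kh ht].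
  by exists h; rewrite // -!catA.
exists n0 => n nn a sa p sp.
case: (pselect (exists q, link H (v ++ p) (v' ++ q))) => [[q l]|no]; last first.
  by left=> q l; apply: no; exists q.
right; pose q1 := q ++ nseq m x0.
have sq1 : m <= size q1 by rewrite size_cat size_nseq leq_addl.
apply: (n0P (take m q1) _ n nn a sa p sp).
  by rewrite mem_words size_takel.
exists (drop m q1); rewrite cat_take_drop; apply: link_trans l _.
by rewrite catA; apply: link_cat.
Qed.

Section Spread.
Variables (H : set (taut X)) (V : seq (seq X)).
Hypotheses (sH : is_subgroup H) (HG : H `<=` G) (fV : forall v, v \in V -> full G H v).
Hypothesis antiV : forall v v', v \in V -> v' \in V -> comparable v v' -> v = v'.
Hypothesis ristV : H `<=` Rist G [set` V].

Definition good u := forall v', v' \in V ->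
  (forall q, ~ link H u (v' ++ q)) \/ exists q, J H u = J H (v' ++ q).

Lemma good_J u u' : J H u = J H u' -> good u -> good u'.
Proof.
by move=> E gu v' v'V; rewrite -E; case: (gu v' v'V) => [no|]; [left=> q; rewrite /link -E;
  apply: no|right].
Qed.

Definition min_good v p := good (v ++ p) /\ forall q, prefix q p -> good (v ++ q) -> q = p.

(** Goodness gives [q] with the fixator of [v ++ p]. If [q] is a prefix of [p'], minimality of [p']
    gives equality; if [p'] is a prefix of [q], goodness of [v' ++ p'] and minimality of [p] do;
    otherwise [link_inv] forbids the links. *)
Lemma min_good_link v p v' p' : v \in V -> v' \in V -> min_good v p -> min_good v' p' ->
  J H (v ++ p) = J H (v' ++ p') \/ forall y, ~ link H (v ++ p) ((v' ++ p') ++ y).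
Proof.
move=> vV v'V [gp mp] [gp' mp']; case: (gp v' v'V) => [no|[q E]].
  by right=> y; rewrite -catA; apply: no.
have fv' := fV v'V; have fv := fV vV.
case: (boolP (prefix q p')) => [qp'|qp'].
  by left; rewrite E -(mp' q qp') //; apply: good_J gp.
case: (boolP (prefix p' q)) => [p'q|p'q]; last first.
  right=> y; rewrite -catA /link E => /(link_inv sG ntG trG ristG sH fv') qp'y.
  by have := prefix_comparable qp'y (prefix_prefix p' y); rewrite (negPf qp') (negPf p'q).
left; have l : link H (v' ++ p') (v ++ p).
  by rewrite /link E; case/prefixP: p'q => r ->; rewrite catA; apply: link_cat.
case: (gp' v vV) => [/(_ p)//|[p3 E3]].
have p3p : prefix p3 p by apply: (link_inv sG ntG trG ristG sH fv); rewrite /link -E3.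
by rewrite E3 (mp p3 p3p) //; apply: good_J gp'.
Qed.

(** One [n] serves all pairs of trees, and all words at its orbit level are good; so shortest good
    prefixes have bounded length. *)
Lemma min_good_exists : exists a, forall v, v \in V -> forall p, a <= size p ->
  exists2 p0, prefix p0 p & size p0 <= a /\ min_good v p0.
Proof.
have [n nP] : exists n, forall vv, vv \in [seq (v, v') | v <- V, v' <- V] -> forall n', n <= n' ->
    forall a, stable_level n' a -> forall p, size p = a ->
    (forall q, ~ link H (vv.1 ++ p) (vv.2 ++ q)) \/ exists q, J H (vv.1 ++ p) = J H (vv.2 ++ q).
  apply: choose_bound => vv /allpairsP[[v v'] /= [vV v'V ->]].
  by apply: link_rigid => //; apply: fV.
have [a [K KP]] := orbit_level_stable sG ntG trG ristG srG primG (d ^ n)%N (ltn0Sn 0).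
have sa : stable_level n a by exists K.
exists a => v vV p ap.
have gp : good (v ++ take a p).
  move=> v' v'V; apply: (nP (v, v') _ n (leqnn n) a sa); last by rewrite size_takel.
  by apply/allpairsP; exists (v, v').
have ex : exists k, `[< good (v ++ take k p) >] by exists a; apply/asboolP.
case: (ex_minnP ex) => k /asboolP gk mk.
have ka : k <= a by apply: mk; apply/asboolP.
exists (take k p); first exact: prefix_take_le.
have sk : size (take k p) = k by rewrite size_takel // (leq_trans ka).
rewrite sk; split=> //; split=> // q qp gq; apply: prefix_size_eq => //; rewrite sk; apply: mk.
apply/asboolP; suff -> : take (size q) p = q by [].
by have /prefixP[s ->] := prefix_trans qp (prefix_take_le k p); rewrite take_size_cat.
Qed.

Lemma block_of_spread : exists2 K : set (taut X), is_subgroup K /\ fi K H & block_subgroup G K.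
Proof.
have [x0 _] := two_letters sG ntG.
have [a aP] := min_good_exists.
pose W := [seq w <- [seq v ++ p | v <- V, p <- flatten [seq words X k | k <- iota 0 a.+1]]
             | `[< exists v p, [/\ v \in V, w = v ++ p & min_good v p] >]].
have WP w : w \in W -> exists v p, [/\ v \in V, w = v ++ p & min_good v p].
  by rewrite mem_filter => /andP[/asboolP].
have Wcover v p : v \in V -> a <= size p -> exists2 w, w \in W & prefix v w && prefix w (v ++ p).
  move=> vV ap; have [p0 p0p [sp0 m0]] := aP v vV p ap.
  exists (v ++ p0); last by rewrite prefix_prefix prefix_cat2l.
  rewrite mem_filter; apply/andP; split; first by apply/asboolP; exists v, p0.
  apply/allpairsP; exists (v, p0); split=> //; apply/flattenP; exists (words X (size p0)).
    by apply: map_f; rewrite mem_iota.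
  by rewrite mem_words.
have antiW w w' : w \in W -> w' \in W -> comparable w w' -> w = w'.
  move=> /WP[v [p [vV -> mp]]] /WP[v' [p' [v'V -> mp']]] c.
  have vv' : v = v'.
    apply: antiV => //; case/orP: c => c.
      have : prefix v (v' ++ p') by apply: prefix_trans c; apply: prefix_prefix.
      by move=> /prefix_comparable/(_ (prefix_prefix v' p')).
    have : prefix v' (v ++ p) by apply: prefix_trans c; apply: prefix_prefix.
    by move=> /prefix_comparable/(_ (prefix_prefix v p)); rewrite comparableC.
  subst v'; congr (_ ++ _); move: c; rewrite /comparable !prefix_cat2l => /orP[] c.
    by apply: mp'.2 => //; case: mp.
  by apply/esym/mp.2 => //; case: mp'.
have Wlink w w' : w \in W -> w' \in W -> J H w = J H w' \/ forall y, ~ link H w (w' ++ y).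
  by move=> /WP[v [p [vV -> mp]]] /WP[v' [p' [v'V -> mp']]]; apply: min_good_link.
pose H1 := [set h | H h /\ forall w, w \in W -> Stv H w h].
have fH1 : fi H1 H by apply: fi_bigI => // w _; apply: fi_Stv.
have sH1 : is_subgroup H1.
  apply: is_subgroupP => [|x [Hx xW]|x y [Hx xW] [Hy yW]]; split.
  - exact: sub1.
  - by move=> w _; apply: (sub1 (Stv_subgroup _ sH)).
  - exact: subV.
  - by move=> w /xW; apply: (subV (Stv_subgroup _ sH)).
  - exact: subM.
  - by move=> w wW; apply: (subM (Stv_subgroup _ sH)); [apply: xW|apply: yW].
have H1w h w : H1 h -> w \in W -> h w = w by move=> [_ hW] /hW[].
have fW w : w \in W -> full G H1 w.
  move=> wW; have [v [p [vV E _]]] := WP w wW; rewrite E; apply: (full_desc sG srG sH (fV vV) sH1).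
  have [_ [C [c cP]]] := fH1; split.
    by move=> h Hh; split; [case: Hh|rewrite -E; apply: H1w].
  by exists C, c => x y [Hx _] [Hy _]; apply: cP.
have trivial_off h t : H h -> (forall w, w \in W -> ~~ comparable w t) -> h t = t.
  move=> Hh no; apply: (ristV Hh).2 => v /= vV; apply/negP => c.
  (* A [t] comparable to [v] is a prefix of some long [v ++ p], which passes through a member of
     [W]; that member is then comparable to [t]. *)
  have [p ap vp] : exists2 p, a <= size p & comparable t (v ++ p) && (size t <= size (v ++ p)).
    case/orP: c => [/prefixP[s ->]|tv].
      exists (s ++ nseq a x0); first by rewrite size_cat size_nseq leq_addl.
      by rewrite /comparable catA prefix_prefix size_cat leq_addr.
    exists (nseq a x0); rewrite ?size_nseq // /comparable.
    have tvp := prefix_trans tv (prefix_prefix v (nseq a x0)); rewrite tvp /=.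
    by case/prefixP: tvp => r ->; rewrite size_cat leq_addr.
  have [w wW /andP[_ wvp]] := Wcover v p vV ap.
  case/andP: vp => vp st; have tvp : prefix t (v ++ p).
    by case/orP: vp => // vpt; rewrite (prefix_size_eq vpt st) prefix_refl.
  by case/negP: (no w wW); apply: prefix_comparable wvp tvp.
have H1_1 h : H1 h -> (forall w, w \in W -> Fix w h) -> h = 1.
  move=> Hh hW; apply/taut_eq => t.
  case: (pselect (exists2 w, w \in W & comparable w t)) => [[w wW c]|no]; last first.
    by apply: trivial_off; [case: Hh|move=> w wW; apply/negP => c; apply: no; exists w].
  case/orP: c => /prefixP[r E]; first by rewrite E hW.
  by have := H1w h w Hh wW; rewrite E => /taut_fix_prefix.
(* The future diagonal block of the class of [u]: the part of [H1] acting only below this class. *)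
pose Kc u := [set h | H1 h /\ forall w, w \in [seq w <- W | `[< J H w <> J H u >]] -> Fix w h].
have KcP u h : Kc u h <-> H1 h /\ forall w, w \in W -> J H w <> J H u -> Fix w h.
  split=> -[Hh hw]; split=> // w.
    by move=> wW n; apply: hw; rewrite mem_filter wW andbT; apply/asboolP.
  by rewrite mem_filter => /andP[/asboolP n wW]; apply: hw.
have sKc u : is_subgroup (Kc u).
  apply: is_subgroupP => [|x [Hx xW]|x y [Hx xW] [Hy yW]]; split.
  - exact: (sub1 sH1).
  - by move=> w _; apply: (sub1 (Fix_subgroup _)).
  - exact: (subV sH1).
  - by move=> w /xW; apply: (subV (Fix_subgroup _)).
  - exact: (subM sH1).
  - by move=> w wW; apply: (subM (Fix_subgroup _)); [apply: xW|apply: yW].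
have KcE u u' : J H u = J H u' -> Kc u = Kc u' by move=> E; rewrite /Kc E.
have KcH1 u : Kc u `<=` H1 by move=> h [].
have fKc u : u \in W -> fi (tsection u @` Kc u) G.
  move=> uW; have fu := fW u uW; have mu := full_morph fu.
  (* No vertex of another class is linked into the tree at [u], so each fixator defining [Kc u]
     moves words everywhere below [u], and so does their intersection. *)
  have mv : moves_below u [::] (Kc u).
    apply: (moves_below_bigI sG ntG trG ristG sH1 fu) => w; rewrite mem_filter =>
      /andP[/asboolP n wW].
    split; first exact: Fix_subgroup.
      by move=> h k Hh kw; rewrite -(H1w h w Hh wW); apply: Fix_conj.
    move=> y' _; case: (Wlink w u wW uW) => [//|/(_ y') nl].
    have [v [p [vV E _]]] := WP u uW.
    apply: contrapT => no; apply: nl; rewrite E -catA;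
      apply: (link_fi sG ntG trG ristG sH (fV vV) sH1 fH1).
    move=> h [[_ hw] H1h] z; apply: contrapT => hz; apply: no; exists h; first by split.
    by exists z; rewrite E -!catA in hz *.
  have f : fi ((tsection u @` Kc u) `&` G) G.
    apply: (fi_normal sG ntG trG ristG fgG torG (full_image sH1 fu) fu.2).
    - by apply: image_subgroup (sKc u) _ => x y /KcH1 Hx /KcH1; apply: mu.
    - move=> _ _ [x Hx <-] [k Kk <-]; have Hk := KcH1 _ _ Kk; exists (x * k * x^-1).
        split; first by do ?apply: (subM sH1) => //; apply: (subV sH1).
        move=> w ww; have wW : w \in W by move: ww; rewrite mem_filter => /andP[].
        by rewrite -(H1w x w Hx wW); apply: Fix_conj; apply: Kk.2.
      by rewrite !mu ?(morphV sH1 mu) //; do ?apply: (subM sH1) => //; apply: (subV sH1).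
    - move=> y; have [k Kk [z kz]] := mv y (prefix0s y); exists (tsection u k); first by exists k.
      by exists z => E; apply: kz; rewrite tsection_eq ?E // (H1w _ _ (KcH1 _ _ Kk) uW).
  apply: fi_between f => [k []//|_ [k Kk <-]]; apply: fu.2.1; exists k => //; exact: KcH1 Kk.
(* Each section at [W] is required to be realised by the block of its class; [K0] turns out to be
   the product of the blocks. *)
pose K0 := [set h | H1 h /\ forall w, w \in W -> [set h | H1 h /\ (tsection w @` Kc w)
  (tsection w h)] h].
have sI w : w \in W -> is_subgroup (tsection w @` Kc w).
  move=> wW; apply: image_subgroup (sKc w) _ => x y /KcH1 Hx /KcH1; exact: (full_morph (fW w wW)).
have sK0' w : w \in W -> is_subgroup [set h | H1 h /\ (tsection w @` Kc w) (tsection w h)].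
  by move=> wW; apply: preimage_subgroup sH1 (full_morph (fW w wW)) (sI w wW).
have sK0 : is_subgroup K0.
  apply: is_subgroupP => [|x [Hx xW]|x y [Hx xW] [Hy yW]]; split.
  - exact: (sub1 sH1).
  - by move=> w wW; apply: (sub1 (sK0' w wW)).
  - exact: (subV sH1).
  - by move=> w wW; apply: (subV (sK0' w wW)); apply: xW.
  - exact: (subM sH1).
  - by move=> w wW; apply: (subM (sK0' w wW)); [apply: xW|apply: yW].
have fK0 : fi K0 H.
  apply: fi_trans fH1 => //; apply: fi_bigI => // w wW.
  by apply: fi_preimage (full_morph (fW w wW)) _ (fKc w wW) => //; case: (fW w wW) => _ [].
exists K0 => //.
pose r u := nth [::] W (find (fun w => `[< J H w = J H u >]) W).
have rP u : u \in W -> r u \in W /\ J H (r u) = J H u.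
  move=> uW; have hs : has (fun w => `[< J H w = J H u >]) W by apply/hasP; exists u => //;
    apply/asboolP.
  split; first by rewrite mem_nth // -has_find.
  by have /asboolP := nth_find [::] hs.
have rE u u' : J H u = J H u' -> r u = r u' by move=> E; rewrite /r E.
pose rs := undup [seq r u | u <- W]; pose b := size rs.
pose R (i : 'I_b) := nth [::] rs i.
have rsP w : w \in rs -> w \in W /\ r w = w.
  by rewrite mem_undup => /mapP[u /rP[ruW Eu] ->]; split=> //; apply: rE.
have RP i : R i \in W /\ r (R i) = R i by apply/rsP/mem_nth.
have Rinj i j : J H (R i) = J H (R j) -> i = j.
  move=> /rE; rewrite (RP i).2 (RP j).2 => /eqP; rewrite nth_uniq ?undup_uniq // => /eqP.
  exact: val_inj.
have Rcov w : w \in W -> exists i, J H w = J H (R i).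
  move=> wW; have rw : r w \in rs by rewrite mem_undup map_f.
  have lt : index (r w) rs < b by rewrite index_mem.
  by exists (Ordinal lt); rewrite /R nth_index // (rP w wW).2.
pose Vi (i : 'I_b) := [set w | w \in W /\ J H w = J H (R i)].
have ViW i : Vi i `<=` [set` W] by move=> w [].
have antiVi (A : set (seq X)) : A `<=` [set` W] -> finite_antichain A.
  move=> AW; split; first exact: sub_finite_set AW (finite_seq W).
  by move=> u w /AW uW /AW wW; apply: antiW.
exists b, Vi; split; first by apply: antiVi => w [i _ /ViW].
  split=> //; last by move=> i _; exists (R i); split=> //; case: (RP i).
  by move=> i j _ _ [w [[_ E1] [_ E2]]]; apply: Rinj; rewrite -E1.
have diag i : diagonal_block G (Vi i) (Kc (R i)).
  split.
  - by split=> //; apply: antiVi; apply: ViW.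
  - move=> h Kh; have [H1h hw] := (KcP (R i) h).1 Kh; have Hh : H h by case: H1h.
    have Gh : G h by exact: HG.
    split; split=> //; last by move=> v [vW _]; apply: H1w.
    move=> t no; case: (pselect (exists2 w, w \in W & comparable w t)) => [[w wW c]|non].
      have nV : J H w <> J H (R i).
        by move=> E; case/negP: (no w (conj wW E)).
      case/orP: c => /prefixP[e E]; first by rewrite E hw.
      by have := H1w h w H1h wW; rewrite E => /taut_fix_prefix.
    by apply: trivial_off => // w wW; apply/negP => c; apply: non; exists w.
  - move=> w [wW E]; rewrite (srG w); apply: fi_finite_index.
      by rewrite -(KcE _ _ E); apply: sI.
    by rewrite -(KcE _ _ E); apply: fKc.
  - move=> w [wW E] g h /[!inE] Kg Kh gh.
    have mw := full_morph (fW w wW).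
    have H1g := KcH1 _ _ Kg; have H1h := KcH1 _ _ Kh.
    have Kgh : Kc (R i) (g^-1 * h) by apply: (subM (sKc _)) => //; apply: (subV (sKc _)).
    have [H1gh gho] := (KcP (R i) _).1 Kgh.
    (* Equal sections at [w] put the quotient in [J H w], so it fixes the trees of the whole class;
       membership in the block handles the other classes. *)
    have ghw : J H w (g^-1 * h).
      split; first by case: H1gh.
      apply/FixE; split; first exact: H1w.
      by rewrite mw ?(morphV sH1 mw) ?gh ?mulVg //; apply: (subV sH1).
    apply/esym; rewrite -[h](mulVKg g) (_ : g^-1 * h = 1) ?mulg1 //.
    apply: H1_1 => // w' w'W; case: (pselect (J H w' = J H (R i))) => [E'|]; last exact: gho.
    by move: ghw; rewrite E -E' => -[].
exists (fun i => Kc (R i)) => //.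
have prodE (k : 'I_b -> taut X) i0 w z : (forall i, Kc (R i) (k i)) -> w \in W ->
  J H w = J H (R i0) ->
    (\prod_(i < b) k i) (w ++ z) = k i0 (w ++ z).
  move=> kK wW E.
  have kw : k i0 w = w by apply: H1w wW; apply: KcH1 (kK i0).
  have off i : i <> i0 -> Fix w (k i).
    by move=> ii; apply: ((KcP (R i) _).1 (kK i)).2 => //; rewrite E => /Rinj/esym.
  suff gen (e : seq 'I_b) : uniq e -> (\prod_(i <- e) k i) (w ++ z) =
      if i0 \in e then k i0 (w ++ z) else w ++ z.
    by rewrite gen ?index_enum_uniq // mem_index_enum.
  elim: e => [|i e IH]; first by rewrite big_nil.
  case/andP=> ie ue; rewrite big_cons tautM IH // inE.
  case: (eqVneq i0 i) => [Ei|/eqP ii] /=; last first.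
    case: ifP => _; last by rewrite off // => /esym.
    by rewrite (tsection_eq _ kw) off // => /esym.
  by rewrite -Ei in ie *; rewrite (negPf ie).
apply/seteqP; split=> [g [H1g gW]|_ [k kK <-]]; last first.
  apply: (big_ind K0); [exact: (sub1 sK0)|by move=> x y; apply: (subM sK0)|move=> i _].
  have Kk := kK i; have H1k := KcH1 _ _ Kk; split=> // w wW; split=> //.
  case: (pselect (J H w = J H (R i))) => [E|n]; first by exists (k i) => //; rewrite (KcE _ _ E).
  exists 1; first exact: (sub1 (sKc w)).
  have /FixE[_ ->] := ((KcP (R i) _).1 Kk).2 w wW n.
  by rewrite (morph1 sH1 (full_morph (fW w wW))).
(* The components of [g] are chosen to agree with it at the representatives [R i], hence on whole
   classes, where fixators coincide. *)
have kex i : exists k, Kc (R i) k /\ tsection (R i) k = tsection (R i) g.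
  by have [_ [k Kk Ek]] := gW (R i) (RP i).1; exists k.
have [k kP] := choice kex.
exists k; first by move=> i; case: (kP i).
have H1p : H1 (\prod_(i < b) k i).
  apply: (big_ind H1); [exact: (sub1 sH1)|by move=> x y; apply: (subM sH1)|move=> i _].
  by apply: (KcH1 (R i)); case: (kP i).
rewrite -[LHS](mulVKg g) (_ : g^-1 * _ = 1) ?mulg1 //.
apply: H1_1 => [|w wW z]; first by apply: (subM sH1) => //; apply: (subV sH1).
have [i0 E] := Rcov w wW; have [Kk Ek] := kP i0; have H1k := KcH1 _ _ Kk.
rewrite tautM (prodE k i0 w z _ wW E); last by move=> i; case: (kP i).
suff -> : k i0 (w ++ z) = g (w ++ z) by rewrite tautK.
have RW := (RP i0).1; have mR := full_morph (fW _ RW).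
have [_ kg] : J H w ((k i0)^-1 * g).
  rewrite E; have H1kg : H1 ((k i0)^-1 * g) by apply: (subM sH1) => //; apply: (subV sH1).
  split; first by case: H1kg.
  apply/FixE; split; first exact: H1w.
  by rewrite mR ?(morphV sH1 mR) ?Ek ?mulVg //; apply: (subV sH1).
have E1 : (k i0)^-1 (g (w ++ z)) = w ++ z by apply: kg.
by rewrite -[RHS](tautVK (k i0)) E1.
Qed.

End Spread.
End Group.
End Blocks.

(** * Subgroup induction *)

Section Induction.
Variable X : finType.
Implicit Types (u v w z y t p q : seq X) (g h : taut X) (H L N : set (taut X)).
Variable G : set (taut X).
Hypotheses (sG : is_subgroup G) (ntG : G <> [set 1]) (trG : level_transitive G).
Hypothesis ristG : forall n : nat, fi (Rist_level G n) G.

Definition spread (V : seq (seq X)) H := [/\ is_subgroup H, H `<=` Rist G [set` V],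
  forall v, v \in V -> full G H v &
  forall v v', v \in V -> v' \in V -> comparable v v' -> v = v'].

Definition virt_spread H := [/\ is_subgroup H, H `<=` G &
  exists V K, fi K H /\ spread V K].

(** The trivial group is spread over the empty set and [G] over the root. For the third condition,
    the sets [V x] found for the sections at letters are hung below those letters. *)
Lemma virt_spread_inductive : inductive_collection G virt_spread.
Proof.
split.
- by move=> H [].
- split.
    split; [exact: subgroup1|by move=> _ ->; apply: sub1|].
    exists [::], [set 1]; split; first exact/fi_refl/subgroup1.
    by split=> //; [exact: subgroup1|move=> _ ->; split=> //; apply: sub1].
  split=> //; exists [:: [::]], G; split; first exact: fi_refl.
  split=> //.
  + by move=> g Gg; split=> // w /(_ [::]); rewrite /= inE => /(_ erefl);
    rewrite /comparable prefix0s.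
  + move=> v; rewrite inE => /eqP->; split; first by move=> h _; apply/nilP;
    rewrite /nilp size_taut.
    rewrite (_ : tsection [::] @` G = G); first exact: fi_refl.
    apply/seteqP; split=> [_ [g Gg <-]|g Gg]; first by rewrite tsection_nil.
    by exists g => //; rewrite tsection_nil.
  + by move=> v v'; rewrite !inE => /eqP-> /eqP->.
- move=> H L [sH HG [V [K [fK sp]]]] sL LG HL; split=> //; exists V, K; split=> //.
  exact: fi_trans sH fK (finite_index_fi sH sL HL).
move=> H sH HSt _ vH; split=> //; first by move=> h /HSt[].
have Hx x h : H h -> h [:: x] = [:: x] by move=> /HSt[_]; apply.
have mH x : morph_on (tsection [:: x]) H by apply: tsection_morph; apply: Hx.
have ex x : exists VK : seq (seq X) * set (taut X),
    fi VK.2 (tsection [:: x] @` H) /\ spread VK.1 VK.2.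
  by have [_ _ [V [K ?]]] := vH x; exists (V, K).
have [f fP] := choice ex.
pose V x := (f x).1; pose K x := (f x).2.
have fK x : fi (K x) (tsection [:: x] @` H) by case: (fP x).
have spK x : spread (V x) (K x) by case: (fP x).
pose H0 := [set h | H h /\ forall x, x \in enum X -> [set h | H h /\ K x (tsection [:: x] h)] h].
have sK x : is_subgroup (K x) by case: (spK x).
have fH0 : fi H0 H.
  by apply: fi_bigI => // x _; apply: (fi_preimage sH (mH x) _ (fK x)).
have sH0 : is_subgroup H0.
  have sP x := preimage_subgroup sH (mH x) (sK x).
  apply: is_subgroupP => [|g [Hg gK]|g h [Hg gK] [Hh hK]]; split.
  - exact: sub1.
  - by move=> x _; apply: (sub1 (sP x)).
  - exact: subV.
  - by move=> x xX; apply: (subV (sP x)); apply: gK.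
  - exact: subM.
  - by move=> x xX; apply: (subM (sP x)); [apply: gK|apply: hK].
have H0K x h : H0 h -> K x (tsection [:: x] h).
  by move=> [_ /(_ x)]; rewrite mem_enum => /(_ isT)[].
pose W := [seq x :: p | x <- enum X, p <- V x].
have WP w : w \in W -> exists x p, p \in V x /\ w = x :: p.
  by move=> /allpairsPdep[x [p [_ pV ->]]]; exists x, p.
exists W, H0; split=> //; split=> //.
- move=> h H0h; split; first by case: H0h => /HSt[].
  move=> [|x t] no; first by apply/nilP; rewrite /nilp size_taut.
  have Hh : H h by case: H0h.
  rewrite -cat1s tsection_eq ?Hx //; congr (_ ++ _).
  have [_ KR _ _] := spK x; apply: (KR _ (H0K x h H0h)).2 => p /= pV.
  have := no (x :: p); rewrite /= /comparable /= eqxx /=; apply.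
  by apply/allpairsPdep; exists x, p; rewrite mem_enum.
- move=> _ /WP[x [p [pV ->]]]; have [_ _ fV _] := spK x.
  pose Q := tsection [:: x] @` H0.
  have mH0 : morph_on (tsection [:: x]) H0 by apply: tsection_morph => h [/Hx].
  have QK : Q `<=` K x by move=> _ [h /H0K Kh <-].
  have fQ : fi Q (K x).
    have [_ [C [c cP]]] := fi_image sH (mH x) fH0; split=> //.
    by exists C, c => g h Kg Kh; apply: cP; apply: (fK x).1.
  have [Qp fQp] := full_fi (sK x) fQ (fV p pV).
  split=> [h H0h|].
    by rewrite -cat1s tsection_eq ?Hx ?(Qp (tsection [:: x] h)) //; [exists h|case: H0h].
  rewrite (_ : tsection (x :: p) @` H0 = tsection p @` Q) //.
  apply/seteqP; split=> [_ [h H0h <-]|_ [_ [h H0h <-] <-]].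
    by exists (tsection [:: x] h); [exists h|rewrite -tsection_cat].
  by exists h => //; rewrite -tsection_cat.
- move=> _ _ /WP[x [p [pV ->]]] /WP[x' [p' [pV' ->]]]; rewrite /comparable /=.
  have [E|//] := eqVneq x x'.
  subst x'; move=> c; congr cons; have [_ _ _ anti] := spK x; exact: anti.
Qed.

Hypothesis sipG : subgroup_induction G.

Lemma sip_spread H : is_subgroup H -> H `<=` G -> finitely_generated H ->
  exists V K, fi K H /\ spread V K.
Proof. by move=> sH HG fgH; case: (sipG virt_spread_inductive sH HG fgH). Qed.

(** The cyclic group of [g] is virtually spread over some [V]. A vertex in [V] would give abelian
    sections of finite index in [G], against [fi_nonabelian]. So [V] is empty, the finite index
    subgroup is trivial, and two powers of [g] coincide. *)
Lemma sip_torsion g : G g -> exists2 n : nat, (0 < n)%N & g ^+ n = 1.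
Proof.
move=> Gg; pose A := generated [set g].
have sA : is_subgroup A := generated_subgroup _.
have AG : A `<=` G by apply: generated_min => // _ ->.
have Ag : A g by apply: generated_sub.
have comA (x y : taut X) : A x -> A y -> x * y = y * x.
  have sC (z : taut X) : is_subgroup [set x | x * z = z * x].
    apply: is_subgroupP => [|a E|a b Ea Eb]; rewrite /= ?mul1g ?mulg1 //.
      by apply: (mulgI a); rewrite mulVKg mulgA E mulgK.
    by rewrite -mulgA Eb mulgA Ea mulgA.
  have cg (z : taut X) : A z -> z * g = g * z.
    suff : A `<=` [set x | x * g = g * x] by apply.
    by apply: generated_min => // _ ->.
  move=> Ax Ay; suff : A `<=` [set z | z * y = y * z] by apply.
  by apply: generated_min => // _ ->; rewrite /= cg.
have [V [K [fK [sK KR fV _]]]] := sip_spread sA AG (ex_intro2 _ _ [set g] (finite_set1 g) erefl).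
case: V KR fV => [|v V] KR fV; last first.
  have [mv fv] := fV v (mem_head v V).
  have sL := full_image sK (conj mv fv).
  have [_ [_ [[a Ka <-] [b Kb <-] _ _ []]]] := fi_nonabelian sG ntG trG ristG [::] sL fv.
  by rewrite -!(full_morph (conj mv fv)) // comA //; apply: fK.1.
have K1 x : K x -> x = 1 by move=> /KR[_ F]; apply/taut_eq => w; apply: F.
have [_ [C [c cP]]] := fK.
have : ~~ injectiveb (fun i : 'I_#|C|.+1 => c (g ^+ i)).
  by apply/injectiveP => /leq_card; rewrite card_ord ltnn.
case/injectivePn => i [j ij E].
wlog lij : i j ij E / i < j.
  move=> W; case: (ltngtP i j) => [|l|/val_inj e]; [exact: W|apply: (W j i) => //|].
    by rewrite eq_sym.
  by rewrite e eqxx in ij.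
exists (j - i)%N; first by rewrite subn_gt0.
have := K1 _ (cP _ _ (subX i sA Ag) (subX j sA Ag) E).
by rewrite -{1}(subnKC (ltnW lij)) expgnDr mulKg.
Qed.

End Induction.

Theorem theorem1p1 (X : finType) (G : set (taut X)) :
  is_subgroup G -> finitely_generated G -> self_replicating G -> branch G ->
  subgroup_induction G -> tree_primitive G ->
  forall H : set (taut X), is_subgroup H -> (H `<=` G)%classic -> finitely_generated H ->
  exists2 K : set (taut X), finite_index K H & block_subgroup G K.
Proof.
move=> sG fgG [[ntG _] srG] [trG ristG] sip primG H sH HG fgH.
have fiG (n : nat) : fi (Rist_level G n) G.
  by apply: finite_index_fi (ristG n) => //; apply: generated_subgroup.
have [V [K [fK [sK KR fV antiV]]]] := sip_spread sG sip sH HG fgH.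
have torG := sip_torsion sG ntG trG fiG sip.
have KG : (K `<=` G)%classic by apply: subset_trans HG; case: fK.
have [L [sL fL] bL] := block_of_spread sG ntG trG fiG (fgP fgG) torG srG primG sK KG fV antiV KR.
by exists L => //; apply: fi_finite_index sL (fi_trans sK fL fK).
Qed.
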